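(* Fix $L>0$. There exist $C<\infty$ and $\varepsilon_0>0$ (depending on $L$) such that for all $0<\varepsilon<\varepsilon_0$, $$\limsup_{t\to\infty}\mathbb{P}\Big\{\sup_{z\in[0,\varepsilon t^{2/3}]}\{N(z)+A_t(z)\}-A_t(0)\ge L\,t^{1/3}\Big\}\le C\varepsilon^3 .$$
   Context: Stationary Hammersley process with parameter $1$: independent Poisson processes of $\alpha$-points (intensity 1 in $(0,\infty)^2$), sources (intensity 1 on $(0,\infty)\times\{0\}$) and sinks (intensity 1 on $\{0\}\times(0,\infty)$). For $0\le z\le t$ let $N(z)$ be the number of sources in $(0,z]\times\{0\}$, and let $A_t(z)$ be the maximal length $k$ of a chain of $\alpha$-points $(x_1,t_1),\dots,(x_k,t_k)\in(z,t]\times(0,t]$ with $x_1<\dots<x_k$, $t_1<\dots<t_k$ (longest strictly North–East path from $(z,0)$ to $(t,t)$). *)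

(* Defs.v *)
From HB Require Import structures.
From mathcomp Require Import all_boot all_order all_algebra.
From mathcomp Require Import finmap all_classical all_reals all_analysis.
Set Implicit Arguments. Unset Strict Implicit. Unset Printing Implicit Defensive.
Import Order.TTheory GRing.Theory Num.Theory.
Local Open Scope classical_set_scope.
Local Open Scope ring_scope.

Definition npts {T : choiceType} {R : realType} (A : set T) : \bar R :=
  if pselect (finite_set A) then ((#|` fset_set A|)%fset%:R)%:E else +oo%E.

Definition outer_prob {d} {Ω : measurableType d} {R : realType}
  (P : probability Ω R) (A : set Ω) : \bar R :=
  ereal_inf [set P B | B in [set B | measurable B /\ A `<=` B]].

(* mutual independence of a finite family of count variables
   (nat-or-+oo valued), via the product rule on the events {f_i = k_i} *)
Definition indep_counts {d} {Ω : measurableType d} {R : realType}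
  (P : probability Ω R) (fs : seq (Ω -> \bar R)) : Prop :=
  forall ks : seq nat, size ks = size fs ->
    P (\bigcap_(i in [set i | (i < size fs)%N])
         [set w | nth (fun _ => 0%E) fs i w = ((nth 0%N ks i)%:R)%:E]) =
    (\prod_(i < size fs)
        P [set w | nth (fun _ => 0%E) fs i w = ((nth 0%N ks i)%:R)%:E])%E.

Definition pairwise_disjoint {T : Type} (Bs : seq (set T)) : Prop :=
  forall i j, (i < size Bs)%N -> (j < size Bs)%N -> i <> j ->
    nth set0 Bs i `&` nth set0 Bs j = set0.

Definition poisson_pp {d} {Ω : measurableType d} {R : realType}
  {dT} {T : measurableType dT}
  (P : probability Ω R) (mu : set T -> \bar R) (D : set T) (X : Ω -> set T)
  : Prop :=
  [/\ forall w, X w `<=` D,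
      forall B, measurable B -> B `<=` D -> (mu B < +oo)%E ->
        forall k : nat,
          measurable [set w | npts (X w `&` B) = (k%:R)%:E :> \bar R] /\
          P [set w | npts (X w `&` B) = (k%:R)%:E :> \bar R] =
            (expR (- fine (mu B)) * fine (mu B) ^+ k / (k`!)%:R)%:E
    & forall Bs : seq (set T), (forall B, B \in Bs -> measurable B) ->
        pairwise_disjoint Bs ->
        indep_counts P [seq (fun w => npts (X w `&` B)) | B <- Bs]].

Definition indep3 {d} {Ω : measurableType d} {R : realType}
  {d1 d2 d3} {T1 : measurableType d1} {T2 : measurableType d2}
  {T3 : measurableType d3}
  (P : probability Ω R) (X1 : Ω -> set T1) (X2 : Ω -> set T2)
  (X3 : Ω -> set T3) : Prop :=
  forall (B1 : seq (set T1)) (B2 : seq (set T2)) (B3 : seq (set T3)),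
    (forall B, B \in B1 -> measurable B) -> pairwise_disjoint B1 ->
    (forall B, B \in B2 -> measurable B) -> pairwise_disjoint B2 ->
    (forall B, B \in B3 -> measurable B) -> pairwise_disjoint B3 ->
    indep_counts P
      ([seq (fun w => npts (X1 w `&` B)) | B <- B1] ++
       [seq (fun w => npts (X2 w `&` B)) | B <- B2] ++
       [seq (fun w => npts (X3 w `&` B)) | B <- B3]).

Definition ne_chain {R : realType} (S : set (R * R)) (s : seq (R * R)) : Prop :=
  (forall p, p \in s -> S p) /\
  sorted (fun p q : R * R => (p.1 < q.1) && (p.2 < q.2)) s.

(* A_t(z): maximal length of a strictly NE chain of alpha-points in
   (z,t] x (0,t] (as an extended real; it is a.s. finite) *)
Definition A_t {R : realType} (alpha : set (R * R)) (t z : R) : \bar R :=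
  ereal_sup [set ((size s)%:R)%:E | s in
    [set s | ne_chain (alpha `&` [set p | z < p.1 <= t /\ 0 < p.2 <= t]) s]].

(* N(z): number of sources in (0,z] (sources = x-coordinates of the
   points of the source process on the positive x-axis) *)
Definition N_src {R : realType} (sources : set R) (z : R) : \bar R :=
  npts (sources `&` [set x | 0 < x <= z]).

Definition exit_event {Ω : Type} {R : realType}
  (alpha : Ω -> set (R * R)) (sources : Ω -> set R) (L eps t : R) : set Ω :=
  [set w | let zs := [set z : R | (0 <= z <= eps * t `^ (2/3))%R] in
     ((L * t `^ (1/3))%:E <=
       ereal_sup [set (N_src (sources w) z + A_t (alpha w) t z)%E | z in zs]
       - A_t (alpha w) t 0)%E].

(* Main.v *)
Require Import Defs.
From HB Require Import structures.
From mathcomp Require Import all_boot all_order all_algebra.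
From mathcomp Require Import finmap all_classical all_reals all_analysis.
From mathcomp Require Import ring lra zify.
Import Order.TTheory GRing.Theory Num.Theory.
Local Open Scope classical_set_scope.
Local Open Scope ring_scope.

(** Cut the square [(0, t]^2] into [n^2] equal cells. As [n] grows, with
    probability tending to [1] no row or column contains two points, and [A_t]
    is then the strict last-passage time of an array of independent Bernoulli
    variables. Computed from the corner [(t, t)], the latter admits stationary
    boundary conditions: with rates [lam] on the top side and [1 / lam] on the
    right side, the increments along the opposite sides are again independent
    Bernoulli variables.

    If the last-passage time from [(0, 0)] with boundary is realised through
    the right side, then [A_t 0 - A_t z] dominates the increment of the
    stationary process, a random walk with rate [lam], independent of the
    sources. With [lam = exp (- r t^(-1/3))] and [r = L / (16 eps)], the drift
    of [N z - (A_t 0 - A_t z)] over [[0, eps t^(2/3)]] is a small fraction of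
    [L t^(1/3)], so that the walk exceeds [L t^(1/3)] with probability
    [exp (- c L^2 / eps)]. The last-passage time is realised through the top
    side with probability at most [3 exp (- r^3 / 20)]: changing the rate of one
    side turns the stationary law of the opposite side into a closed formula for
    an exponential moment of the last-passage time with arbitrary boundary rates,
    and Markov's inequality separates the two one-sided last-passage times.
    Both bounds are [O(eps^3)]. *)

(** * Independent Bernoulli variables *)

Section BernoulliExpectation.
Context {R : realType}.
Implicit Types (p q c : R) (ps qs : seq R) (f g : seq bool -> R).

(** Expectation of [f] over independent bits with success probabilities [ps]. Independence of two
    families is nesting of [bexp]. *)
Fixpoint bexp ps f : R :=
  if ps is p :: ps' then
    p * bexp ps' (fun s => f (true :: s)) +
    (1 - p) * bexp ps' (fun s => f (false :: s))
  else f [::].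

Definition probs ps := all (fun p => 0 <= p <= 1) ps.

Lemma probs_nseq n p : 0 <= p <= 1 -> probs (nseq n p).
Proof. by move=> h; rewrite /probs all_nseq h orbT. Qed.

Lemma eq_bexp ps f g : (forall s, size s = size ps -> f s = g s) ->
  bexp ps f = bexp ps g.
Proof.
elim: ps f g => [|p ps IH] f g fg /=; first exact: fg.
by congr (_ * _ + _ * _); apply: IH => s hs; apply: fg; rewrite /= hs.
Qed.

Lemma le_bexp ps f g : probs ps -> (forall s, size s = size ps -> f s <= g s) ->
  bexp ps f <= bexp ps g.
Proof.
elim: ps f g => [|p ps IH] f g /=; first by move=> _; apply.
move=> /andP[/andP[p0 p1] hps] fg.
by apply: lerD; apply: ler_wpM2l; rewrite ?subr_ge0 //; apply: IH => // s hs;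
  apply: fg; rewrite /= hs.
Qed.

Lemma bexpD ps f g : bexp ps (fun s => f s + g s) = bexp ps f + bexp ps g.
Proof. by elim: ps f g => [|p ps IH] f g //=; rewrite !IH; ring. Qed.

Lemma bexpZ ps c f : bexp ps (fun s => c * f s) = c * bexp ps f.
Proof. by elim: ps f => [|p ps IH] f //=; rewrite !IH; ring. Qed.

Lemma bexp_cst ps c : bexp ps (fun=> c) = c.
Proof. by elim: ps => [|p ps IH] //=; rewrite !IH; ring. Qed.

Lemma bexp_cat ps qs f :
  bexp (ps ++ qs) f = bexp ps (fun s => bexp qs (fun s' => f (s ++ s'))).
Proof. by elim: ps f => [|p ps IH] f //=; rewrite !IH. Qed.

Lemma bexp_exchange ps qs (h : seq bool -> seq bool -> R) :
  bexp ps (fun s => bexp qs (h s)) = bexp qs (fun s' => bexp ps (h^~ s')).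
Proof.
elim: ps h => [|p ps IH] h //=.
by rewrite bexpD !bexpZ !IH.
Qed.

(** Used because the source strips are read from the left of the square, whereas the array starts at
    its right. *)
Lemma bexp_rev_nseq n p f : bexp (nseq n p) f = bexp (nseq n p) (fun s => f (rev s)).
Proof.
elim: n f => [|n IH] f //; rewrite [LHS]/= -addn1 nseqD bexp_cat /=.
rewrite (IH (fun s => f (true :: s))) (IH (fun s => f (false :: s))).
by rewrite bexpD !bexpZ; congr (_ * _ + _ * _); apply: eq_bexp => s _;
  rewrite rev_cat.
Qed.

End BernoulliExpectation.

(** * Last-passage times with boundary *)

Section LocalRule.

(* [u], [v] are the increments of a strict last-passage time along the bottom
   and left edges of a cell, [w] its weight; the increments along the opposite
   edges are [max u v w - v] and [max u v w - u]. *)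
Definition cell_h (u v w : bool) := ~~ v && (u || w).
Definition cell_v (u v w : bool) := ~~ u && (v || w).

Fixpoint row_step (us : seq bool) (v : bool) (ws : seq bool) : seq bool * bool :=
  if us is u :: us' then
    let r := row_step us' (cell_v u v (head false ws)) (behead ws) in
    (cell_h u v (head false ws) :: r.1, r.2)
  else ([::], v).

Fixpoint hrun n (us vs ws : seq bool) : seq bool * seq bool :=
  if vs is v :: vs' then
    let r := row_step us v (take n ws) in
    let r' := hrun n r.1 vs' (drop n ws) in (r'.1, r.2 :: r'.2)
  else (us, [::]).

Lemma size_row_step us v ws : size (row_step us v ws).1 = size us.
Proof. by elim: us v ws => //= u us IH v ws; rewrite IH. Qed.

Lemma size_hrun n us vs ws :
  size (hrun n us vs ws).1 = size us /\ size (hrun n us vs ws).2 = size vs.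
Proof.
elim: vs us ws => //= v vs IH us ws.
by have [-> ->] := IH (row_step us v (take n ws)).1 (drop n ws); rewrite size_row_step.
Qed.

Context {R : realType}.
Variables (a b w : R).
Hypothesis burke : a * b = (1 - a) * (1 - b) * w.

(** In one cell the pair of increments changes only by [(1, 1) -> (0, 0)] and, when the weight is
    [1], by [(0, 0) -> (1, 1)]. The hypothesis [burke] says that these transitions are equally
    likely, so the outgoing pair has the law of the incoming one; its vertical part then feeds the
    rest of the row. *)
Lemma row_step_burke n (f : seq bool -> bool -> R) :
  bexp (nseq n a) (fun us => bexp [:: b] (fun v => bexp (nseq n w) (fun ws =>
    f (row_step us (head false v) ws).1 (row_step us (head false v) ws).2)))
  = bexp (nseq n a) (fun us => bexp [:: b] (fun v => f us (head false v))).
Proof.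
elim: n f => [|n IH] f //=.
(* [F u1 v] averages over the rest of the row, given the outputs [u1] and [v] of the first cell. *)
pose F u1 v := bexp (nseq n a) (fun us => bexp (nseq n w) (fun ws =>
   f (u1 :: (row_step us v ws).1) (row_step us v ws).2)).
have IH' u1 : b * F u1 true + (1 - b) * F u1 false =
   bexp (nseq n a) (fun us => b * f (u1 :: us) true + (1 - b) * f (u1 :: us) false).
  have := IH (fun us v => f (u1 :: us) v).
  by rewrite /= !bexpD !bexpZ => ->.
rewrite -!IH' !(bexpD, bexpZ) -/(F _ _) /cell_h /cell_v /= -/(F _ _).
rewrite -/(F true true) -/(F true false) -/(F false true) -/(F false false).
set A := F true true; set B := F true false; set C := F false true.
set D := F false false.
suff : (a * b - (1 - a) * (1 - b) * w) * (D - A) = 0 by lra.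
by rewrite burke subrr mul0r.
Qed.

(** The increments leaving a row at its top are again i.i.d. and independent of the one leaving at
    its right end, so the remaining rows start afresh. *)
Lemma hrun_burke n m (f : seq bool -> seq bool -> R) :
  bexp (nseq n a) (fun us => bexp (nseq m b) (fun vs => bexp (nseq (m * n) w)
    (fun ws => f (hrun n us vs ws).1 (hrun n us vs ws).2)))
  = bexp (nseq n a) (fun us => bexp (nseq m b) (fun vs => f us vs)).
Proof.
elim: m f => [|m IH] f //.
pose G v us := bexp (nseq m b) (fun vs => bexp (nseq (m * n) w) (fun ws =>
  f (hrun n us vs ws).1 (v :: (hrun n us vs ws).2))).
transitivity (bexp (nseq n a) (fun us => bexp [:: b] (fun v => bexp (nseq n w)
   (fun ws => G (row_step us (head false v) ws).2 (row_step us (head false v) ws).1)))).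
  apply: eq_bexp => us _; rewrite -[m.+1]/(1 + m)%N nseqD bexp_cat.
  apply: eq_bexp => -[|v[|//]] //= _; rewrite mulnDl mul1n nseqD.
  under eq_bexp do rewrite bexp_cat; rewrite bexp_exchange.
  apply: eq_bexp => ws; rewrite size_nseq => hws; rewrite /G; apply: eq_bexp => vs _.
  apply: eq_bexp => ws' _ /=.
  by rewrite -hws take_size_cat // drop_size_cat.
rewrite (row_step_burke n (fun us v => G v us)) bexp_exchange.
under [RHS]eq_bexp do rewrite -[m.+1]/(1 + m)%N nseqD bexp_cat.
rewrite [RHS]bexp_exchange; apply: eq_bexp => -[|v[|//]] //= _.
exact: (IH (fun us vs => f us (v :: vs))).
Qed.

End LocalRule.

(** * The last-passage recursion, comparison of boundaries, edge increments *)

Section LastPassage.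
Local Open Scope nat_scope.
Implicit Types (N M : nat -> nat) (W : nat -> nat -> bool) (i j : nat).

(** [N] and [M] prescribe the bottom row and the left column. A weight is collected on diagonal
    steps only, which makes the paths strict. *)
Fixpoint lpp N M W j : nat -> nat :=
  if j is j'.+1 then
    fix row i := if i is i'.+1 then
      maxn (maxn (row i') (lpp N M W j' i'.+1)) (lpp N M W j' i' + W i' j')
      else M j'.+1
  else N.

Lemma lppS N M W j i : lpp N M W j.+1 i.+1 =
  maxn (maxn (lpp N M W j.+1 i) (lpp N M W j i.+1)) (lpp N M W j i + W i j).
Proof. by []. Qed.

Lemma lpp_row0 N M W i : lpp N M W 0 i = N i.
Proof. by []. Qed.

Lemma lpp_col0 N M W j : N 0 = M 0 -> lpp N M W j 0 = M j.
Proof. by case: j. Qed.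

Lemma lpp_ind (Q : nat -> nat -> Prop) : (forall i, Q 0 i) -> (forall j, Q j.+1 0) ->
  (forall i j, Q j.+1 i -> Q j i.+1 -> Q j i -> Q j.+1 i.+1) -> forall j i, Q j i.
Proof.
move=> h0 h1 hS; elim=> [|j IHj]; first exact: h0.
by elim=> [|i IHi]; [exact: h1|exact: hS].
Qed.

(** The recursion consists of maxima and of additions of weights, so it commutes with the maximum of
    two boundary data. *)
Lemma lpp_max N M W j i :
  N 0 = 0 -> M 0 = 0 ->
  lpp N M W j i = maxn (lpp N (fun=> 0) W j i) (lpp (fun=> 0) M W j i).
Proof.
move=> N0 M0; move: j i; apply: lpp_ind => [i|j|i j].
- by rewrite !lpp_row0 maxn0.
- by rewrite /= max0n.
- by rewrite !lppS => -> -> ->; lia.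
Qed.

(** Crossing inequalities pass through a cell: smaller horizontal increments at the bottom ([H]) and
    larger vertical ones at the left ([V]) persist on the opposite edges. Thus [H] in row [j] gives
    [V] between rows [j] and [j + 1], and both give [H] in row [j + 1]. *)
Lemma lpp_hincr_le N M M' W : N 0 = M 0 -> N 0 = M' 0 ->
  (forall j, M j.+1 + M' j <= M' j.+1 + M j) -> forall j i k,
  lpp N M' W j (i + k) + lpp N M W j i <= lpp N M W j (i + k) + lpp N M' W j i.
Proof.
move=> NM NM' hM.
pose H j i := lpp N M' W j i.+1 + lpp N M W j i <= lpp N M W j i.+1 + lpp N M' W j i.
pose V j i := lpp N M W j.+1 i + lpp N M' W j i <= lpp N M' W j.+1 i + lpp N M W j i.
have HV j : (forall i, H j i) -> forall i, V j i.
  rewrite /H /V => hH; elim=> [|i IH]; first by rewrite !lpp_col0.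
  by rewrite !lppS; have := hH i; move: IH; lia.
have HH j i : H j i.
  elim: j i => [|j IH] i; first by rewrite /H /= addnC.
  have := HV _ IH i; have := IH i; rewrite /H /V !lppS; lia.
by move=> j i; elim=> [|k IH]; rewrite ?addn0 ?addnS 1?addnC //; have := HH j (i + k);
  rewrite /H; lia.
Qed.

Lemma lpp_mono N M W j i k : {homo N : x y / x <= y} ->
  lpp N M W j i <= lpp N M W j (i + k).
Proof.
move=> hN; case: j => [|j]; first by rewrite !lpp_row0; apply: hN; lia.
by elim: k => [|k IH]; rewrite ?addn0 // addnS lppS; lia.
Qed.

Lemma lpp_mono_row M W j i k : {homo M : x y / x <= y} ->
  lpp (fun=> M 0) M W j i <= lpp (fun=> M 0) M W (j + k) i.
Proof.
move=> hM; elim: k => [|k IH]; rewrite ?addn0 // addnS.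
by case: i IH => [|i] IH; [rewrite !lpp_col0 //; apply: hM; lia | rewrite lppS; lia].
Qed.

Definition shiftr W i j := W i j.+1.

(** Row [1] serves as a new bottom boundary, matching the row-by-row recursion of [hrun]. *)
Lemma lpp_shift N M W j i :
  lpp N M W j.+1 i = lpp (lpp N M W 1) (fun j => M j.+1) (shiftr W) j i.
Proof.
move: j i; apply: lpp_ind => [//|//|i j h1 h2 h3].
by rewrite lppS h1 h2 h3.
Qed.

Lemma row_step_lpp us (v : bool) ws (N G : nat -> nat) :
  (forall i, i < size us -> N i.+1 = N i + nth false us i) ->
  G 0 = N 0 + v ->
  (forall i, i < size us ->
     G i.+1 = maxn (maxn (G i) (N i.+1)) (N i + nth false ws i)) ->
  (forall i, i < size us -> G i.+1 = G i + nth false (row_step us v ws).1 i) /\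
  G (size us) = N (size us) + (row_step us v ws).2.
Proof.
elim: us v ws N G => [|u us IH] v ws N G hN G0 hG //=.
have hN0 := hN 0 isT; have hG0 := hG 0 isT; rewrite /= in hN0.
rewrite nth0 in hG0.
have [] := IH (cell_v u v (head false ws)) (behead ws) (fun i => N i.+1) (fun i => G i.+1).
- by move=> i hi; rewrite (hN i.+1).
- by rewrite hG0 G0 hN0 /cell_v; case: (u) (v) (head false ws) => [] [] [] /=; lia.
- by move=> i hi; rewrite (hG i.+1) // nth_behead.
move=> IH1 IH2; split=> // -[|i] hi /=; last exact: IH1.
rewrite hG0 G0 hN0 /cell_h.
by case: (u) (v) (head false ws) => [] [] [] /=; lia.
Qed.

Lemma hrun_lpp n us vs ws N M W :
  size us = n -> N 0 = M 0 ->
  (forall i, i < n -> N i.+1 = N i + nth false us i) ->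
  (forall j, j < size vs -> M j.+1 = M j + nth false vs j) ->
  (forall i j, i < n -> j < size vs -> W i j = nth false ws (j * n + i)) ->
  (forall i, i < n -> lpp N M W (size vs) i.+1 =
     lpp N M W (size vs) i + nth false (hrun n us vs ws).1 i) /\
  (forall j, j < size vs -> lpp N M W j.+1 n =
     lpp N M W j n + nth false (hrun n us vs ws).2 j).
Proof.
move=> szu; elim: vs us szu ws N M W => [|v vs IH] us szu ws N M W NM hN hM hW //.
have [] := @row_step_lpp us v (take n ws) N (lpp N M W 1); rewrite ?szu //.
- by rewrite /= (hM 0) //= NM.
- by move=> i hi; rewrite lppS lpp_row0 hW // mul0n add0n nth_take.
move=> R1 R2.
have [] := IH (row_step us v (take n ws)).1 _ (drop n ws) (lpp N M W 1)
  (fun j => M j.+1) (shiftr W); rewrite ?size_row_step //.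
- by move=> j hj; rewrite (hM j.+1).
- by move=> i j hi hj; rewrite /shiftr hW // nth_drop mulSn addnA.
move=> I1 I2; split=> [i hi|[|j] hj].
- by rewrite [size _]/= !lpp_shift I1.
- by rewrite [nth _ _ _]/=; exact: R2.
- by rewrite [LHS]lpp_shift [in RHS]lpp_shift I2.
Qed.

Definition pcount (us : seq bool) i := count id (take i us).

Lemma pcountS us i : pcount us i.+1 = pcount us i + nth false us i.
Proof.
rewrite /pcount; elim: us i => [|u us IH] [|i] //=.
  by rewrite take0 /= addn0.
by rewrite IH addnA.
Qed.

Lemma pcount_size us n : size us = n -> pcount us n = count id us.
Proof. by move=> <-; rewrite /pcount take_size. Qed.

Definition flatW n (ws : seq bool) i j := nth false ws (j * n + i).

End LastPassage.

(** * Bounds for the exponential *)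

Section ExpBounds.
Context {R : realType}.
Implicit Types (x y b : R).

Lemma ge0_of_derive (f g : R -> R) b : (forall x, is_derive x 1 f (g x)) ->
  0 <= f 0 -> (forall x, 0 <= x <= b -> 0 <= g x) ->
  forall x, 0 <= x <= b -> 0 <= f x.
Proof.
move=> df f0 g0 x /andP[x0 xb]; apply: (le_trans f0).
have df' y : derivable f y 1 by have [] := df y.
apply: (@ger0_derive1_ndecr _ f 0 b) => // [y|].
- rewrite in_itv /= => /andP[y0 yb]; rewrite derive1E.
  by rewrite (@derive_val _ _ _ _ _ _ _ (df y)) g0 // !ltW.
- apply: derivable_within_continuous => y _; exact: df'.
Qed.

Definition sh x := expR x - expR (- x).

Lemma shN x : sh (- x) = - sh x.
Proof. by rewrite /sh opprK opprB. Qed.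

Lemma sh_ge0 x : 0 <= x -> 0 <= sh x.
Proof. by move=> x0; rewrite subr_ge0 ler_expR; lra. Qed.

Lemma ch_ge2 x : 2 <= expR x + expR (- x).
Proof. by have := expR_ge1Dx x; have := expR_ge1Dx (- x); lra. Qed.

(** Three integrations from [0], starting from [2 <= expR y + expR (- y)]; [sh] is twice the
    hyperbolic sine. *)
Lemma sh_ge x : 0 <= x -> 2 * x + x ^+ 3 / 3 <= sh x.
Proof.
move=> x0; rewrite -subr_ge0; move: x {x0}(x0).
have step (f g : R -> R) : (forall x, is_derive x 1 f (g x)) -> 0 <= f 0 ->
    (forall x, 0 <= x -> 0 <= g x) -> forall x, 0 <= x -> 0 <= f x.
  move=> df f0 g0 x x0; apply: (ge0_of_derive _ _ x df f0); last by rewrite x0 /=.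
  by move=> y /andP[y0 _]; exact: g0.
apply: (step _ (fun y => expR y + expR (- y) - 2 - y ^+ 2)).
- move=> y; rewrite /sh; apply: is_derive_eq.
  rewrite /GRing.scale /=; lra.
- by rewrite /sh oppr0; lra.
apply: (step _ (fun y => expR y - expR (- y) - 2 * y)).
- move=> y; apply: is_derive_eq; rewrite /GRing.scale /=; lra.
- by rewrite oppr0 expR0; lra.
apply: (step _ (fun y => expR y + expR (- y) - 2)).
- move=> y; apply: is_derive_eq; rewrite /GRing.scale /=; lra.
- by rewrite oppr0 expR0; lra.
by move=> y _; have := ch_ge2 y; lra.
Qed.

(** The bound [expR y + expR (- y) <= 12 / 5] on [[0, 1 / 4]], integrated repeatedly, produces the
    coefficients [6 / 5] and [2 / 5]. *)
Lemma ch_sh_le x : 0 <= x <= 1 / 4 ->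
  expR x + expR (- x) <= 2 + 6 / 5 * x ^+ 2 /\ sh x <= 2 * x + 2 / 5 * x ^+ 3.
Proof.
have h1 y : 0 <= y <= 1 / 4 -> 0 <= 12 / 5 - (expR y + expR (- y)).
  move=> /andP[y0 y1]; have : expR (- y) <= 1 by rewrite expR_le1; lra.
  have := expR_ge1Dx (- y); have := expRxMexpNx_1 y; have := expR_gt0 y; nra.
have h2 : forall y, 0 <= y <= 1 / 4 -> 0 <= 12 / 5 * y - sh y.
  apply: (ge0_of_derive _ _ _ _ _ h1).
  - move=> y; rewrite /sh; apply: is_derive_eq; rewrite /GRing.scale /=; lra.
  - by rewrite /sh oppr0; lra.
have h3 : forall y, 0 <= y <= 1 / 4 -> 0 <= 2 + 6 / 5 * y ^+ 2 - (expR y + expR (- y)).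
  apply: (ge0_of_derive _ _ _ _ _ h2).
  - move=> y; rewrite /sh; apply: is_derive_eq; rewrite /GRing.scale /=; lra.
  - by rewrite oppr0 expR0; lra.
have h4 : forall y, 0 <= y <= 1 / 4 -> 0 <= 2 * y + 2 / 5 * y ^+ 3 - sh y.
  apply: (ge0_of_derive _ _ _ _ _ h3).
  - move=> y; rewrite /sh; apply: is_derive_eq; rewrite /GRing.scale /=; lra.
  - by rewrite /sh oppr0; lra.
by move=> hx; split; rewrite -subr_ge0; [exact: h3|exact: h4].
Qed.

End ExpBounds.

(** * Exponential moments of last-passage times *)

Section ExponentialMoment.
Context {R : realType}.
Implicit Types (a b w x y l sig : R) (us vs ws : seq bool).

Definition oddsp a := a / (1 + a).

Lemma oddsp01 a : 0 <= a -> 0 <= oddsp a <= 1.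
Proof.
move=> a0; have a1 : 0 < 1 + a by lra.
by rewrite /oddsp divr_ge0 ?ler_pdivrMr ?mul1r //; lra.
Qed.

(** Exponential change of measure: a weight [x] per success multiplies the odds by [x], with
    normalisation [(1 + a) / (1 + a')] per bit. *)
Lemma bexp_tilt n a' a x (F : seq bool -> R) : 0 <= a' -> 0 <= a -> a' * x = a ->
  bexp (nseq n (oddsp a')) (fun us => x ^+ count id us * F us) =
  ((1 + a) / (1 + a')) ^+ n * bexp (nseq n (oddsp a)) F.
Proof.
move=> a'0 a0 E; elim: n F => [|n IH] F /=; first by rewrite !expr0 mul1r.
under eq_bexp do rewrite addnC exprD expr1 -mulrA mulrCA.
under [X in _ + _ * X]eq_bexp do rewrite add0n.
rewrite bexpZ IH IH /oddsp exprS -E; field.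
by rewrite E; apply/andP; split; apply: lt0r_neq0; lra.
Qed.

Lemma bexp_mgf n a x : 0 <= a -> 0 <= a * x ->
  bexp (nseq n (oddsp a)) (fun us => x ^+ count id us) = ((1 + a * x) / (1 + a)) ^+ n.
Proof.
move=> a0 ax0; under eq_bexp do rewrite -[_ ^+ _]mulr1.
by rewrite (bexp_tilt _ _ (a * x)) // bexp_cst mulr1.
Qed.

(** The bottom and left edges of the array are the top and right sides of the square, since the
    array starts at the corner [(t, t)]; hence the names. *)
Definition top_lpp n us ws := lpp (pcount us) (fun=> 0%N) (flatW n ws) n n.
Definition right_lpp n vs ws := lpp (fun=> 0%N) (pcount vs) (flatW n ws) n n.
Definition full_lpp n us vs ws := lpp (pcount us) (pcount vs) (flatW n ws) n n.

Lemma full_lpp_max n us vs ws :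
  full_lpp n us vs ws = maxn (top_lpp n us ws) (right_lpp n vs ws).
Proof. by rewrite /full_lpp lpp_max /pcount ?take0. Qed.

Lemma hrun_blpp n us vs ws : size us = n -> size vs = n ->
  let G := lpp (pcount us) (pcount vs) (flatW n ws) in
  (forall i, (i < n)%N -> G n i.+1 = (G n i + nth false (hrun n us vs ws).1 i)%N) /\
  (forall j, (j < n)%N -> G j.+1 n = (G j n + nth false (hrun n us vs ws).2 j)%N).
Proof.
move=> su sv G.
have [] := @hrun_lpp n us vs ws (pcount us) (pcount vs) (flatW n ws) su.
- by rewrite /pcount !take0.
- by move=> i _; rewrite pcountS.
- by move=> i _; rewrite pcountS.
- by [].
by rewrite sv.
Qed.

(** Telescoping along the bottom edge of the array and then up its right edge. *)
Lemma full_lpp_right n us vs ws : size us = n -> size vs = n ->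
  full_lpp n us vs ws = (count id us + count id (hrun n us vs ws).2)%N.
Proof.
move=> su sv; have [_ H] := hrun_blpp n us vs ws su sv.
have [_ sr] := size_hrun n us vs ws.
rewrite -(pcount_size _ _ su) -(pcount_size (hrun n us vs ws).2 n) ?sr //.
suff E j : (j <= n)%N -> lpp (pcount us) (pcount vs) (flatW n ws) j n =
    (pcount us n + pcount (hrun n us vs ws).2 j)%N by exact: E.
elim: j => [|j IH] hj; first by rewrite lpp_row0 {3}/pcount take0 addn0.
by rewrite H // IH ?(ltnW hj) // pcountS addnA.
Qed.

(** Telescoping along the top edge of the array, backwards from its right end, which is the left end
    of the source axis; hence the reversal. *)
Lemma full_lpp_top n us vs ws k : size us = n -> size vs = n -> (k <= n)%N ->
  full_lpp n us vs ws = (lpp (pcount us) (pcount vs) (flatW n ws) n (n - k) +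
     pcount (rev (hrun n us vs ws).1) k)%N.
Proof.
move=> su sv; have [H _] := hrun_blpp n us vs ws su sv.
have [sr _] := size_hrun n us vs ws.
elim: k => [|k IH] hk; first by rewrite subn0 /pcount take0 addn0.
rewrite IH ?(ltnW hk) // pcountS nth_rev ?sr ?su // addnA addnAC.
by congr (_ + _)%N; rewrite -H ?subnSK //; lia.
Qed.

(* Tilting the bottom edge from odds [a] to the stationary odds [w / b] absorbs
   the factor coming from the bottom edge; what is left is a functional of the
   right edge, whose law is known by Burke's property. *)
Lemma full_lpp_mgf n a b w : 0 < a -> 0 < b -> 0 < w ->
  bexp (nseq n (oddsp a)) (fun us => bexp (nseq n (oddsp b)) (fun vs =>
    bexp (nseq (n * n) w) (fun ws => (w / (a * b)) ^+ full_lpp n us vs ws))) =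
  ((1 + w / b) / (1 + a)) ^+ n * ((1 + w / a) / (1 + b)) ^+ n.
Proof.
move=> a0 b0 w0; set x := w / (a * b).
have ne : (a != 0) && (b != 0) by rewrite !gt_eqF.
have [an bn] := andP ne.
have x0 : 0 < x by rewrite divr_gt0 ?mulr_gt0.
transitivity (bexp (nseq n (oddsp a)) (fun us => x ^+ count id us *
  bexp (nseq n (oddsp b)) (fun vs => bexp (nseq (n * n) w) (fun ws =>
     x ^+ count id (hrun n us vs ws).2)))).
  apply: eq_bexp => us; rewrite size_nseq => su; rewrite -bexpZ.
  apply: eq_bexp => vs; rewrite size_nseq => sv; rewrite -bexpZ.
  by apply: eq_bexp => ws _; rewrite full_lpp_right // exprD.
rewrite (bexp_tilt _ _ (w / b)) ?ltW ?divr_gt0 //; last first.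
  by rewrite /x; field; rewrite ?an ?bn.
rewrite (hrun_burke (oddsp (w / b)) (oddsp b) w _ n n (fun _ vs => x ^+ count id vs)).
  have bx0 := mulr_gt0 b0 x0; rewrite bexp_cst bexp_mgf ?ltW //.
  by congr (_ * ((_ + _) / _) ^+ _); rewrite /x; field; rewrite ?an ?bn.
have h1 : 0 < b + w by lra.
have h2 : 0 < 1 + b by lra.
by rewrite /oddsp; field; rewrite !gt_eqF //; lra.
Qed.

Definition mgf_factor sig x := (1 + sig * expR (- x)) / (1 + sig * expR x).

(** In these parameters stationarity is [x + y = 0]; the closed formula becomes an exponential
    moment of order [- (x + y)] and splits into one factor per side. *)
Lemma full_lpp_mgf_exp n sig x y : 0 < sig -> 
  bexp (nseq n (oddsp (sig * expR x))) (fun us =>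
    bexp (nseq n (oddsp (sig * expR y))) (fun vs =>
    bexp (nseq (n * n) (sig ^+ 2)) (fun ws =>
      expR (- (x + y) * (full_lpp n us vs ws)%:R)))) =
  mgf_factor sig x ^+ n * mgf_factor sig y ^+ n.
Proof.
move=> s0; have e0 z := expR_gt0 z : 0 < expR z :> R.
have en z : expR z != 0 :> R by rewrite gt_eqF.
have sn : sig != 0 by rewrite gt_eqF.
have := @full_lpp_mgf n (sig * expR x) (sig * expR y) (sig ^+ 2)
  (mulr_gt0 s0 (e0 x)) (mulr_gt0 s0 (e0 y)) (exprn_gt0 2 s0).
have -> : sig ^+ 2 / (sig * expR x * (sig * expR y)) = expR (- (x + y)).
  by rewrite opprD expRD !expRN; field; rewrite !en.
have E z : sig ^+ 2 / (sig * expR z) = sig * expR (- z).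
  by rewrite expRN; field; rewrite !en.
rewrite !E => H; transitivity (((1 + sig * expR (- y)) / (1 + sig * expR x)) ^+ n *
   ((1 + sig * expR (- x)) / (1 + sig * expR y)) ^+ n).
  rewrite -H; apply: eq_bexp => us _; apply: eq_bexp => vs _; apply: eq_bexp => ws _.
  by rewrite expRM_natr.
rewrite -!exprMn /mgf_factor; congr (_ ^+ _); field.
by rewrite !gt_eqF //; apply: addr_gt0 => //; apply: mulr_gt0.
Qed.

Lemma mgf_factor_gt0 sig x : 0 < sig -> 0 < mgf_factor sig x.
Proof.
by move=> s0; apply: divr_gt0; apply: addr_gt0 => //; apply: mulr_gt0 => //;
  exact: expR_gt0.
Qed.

Lemma mgf_factor_le sig x : 0 < sig ->
  mgf_factor sig x <= expR (- (sig / (1 + sig * expR x) * sh x)).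
Proof.
move=> s0; have d0 : 0 < 1 + sig * expR x.
  by apply: addr_gt0 => //; apply: mulr_gt0 => //; exact: expR_gt0.
apply: le_trans (expR_ge1Dx _).
suff -> : mgf_factor sig x = 1 + - (sig / (1 + sig * expR x) * sh x) by [].
by rewrite /mgf_factor /sh; field; rewrite gt_eqF.
Qed.

Lemma mgf_factorN_le n sig x t : 0 < sig -> 0 <= x -> n%:R * sig <= t ->
  mgf_factor sig (- x) ^+ n <= expR (t * sh x).
Proof.
move=> s0 x0 hn; rewrite (le_trans (y := expR (sig * sh x) ^+ n)) //.
  apply: lerXn2r; rewrite ?nnegrE ?expR_ge0 ?(ltW (mgf_factor_gt0 _ _ s0)) //.
  apply: le_trans (mgf_factor_le _ _ s0) _; rewrite ler_expR shN mulrN opprK.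
  apply: ler_wpM2r; first exact: sh_ge0.
  have e0 := expR_gt0 (- x).
  by rewrite ler_pdivrMr; nra.
by rewrite -expRM_natl ler_expR mulrA; apply: ler_wpM2r => //; exact: sh_ge0.
Qed.

Lemma mgf_factor_expn_le n sig x t : 0 < sig -> 0 <= x ->
  t <= n%:R * (sig / (1 + sig * expR x)) ->
  mgf_factor sig x ^+ n <= expR (- (t * sh x)).
Proof.
move=> s0 x0 hn.
rewrite (le_trans (y := expR (- (sig / (1 + sig * expR x) * sh x)) ^+ n)) //.
  apply: lerXn2r; rewrite ?nnegrE ?expR_ge0 ?(ltW (mgf_factor_gt0 _ _ s0)) //.
  exact: mgf_factor_le.
rewrite -expRM_natl ler_expR mulrN lerN2 mulrA; apply: ler_wpM2r => //.
exact: sh_ge0.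
Qed.

(** Markov's inequality. The hypothesis on [A] describes an upper tail when [x + y < 0] and a lower
    tail when [x + y > 0]. *)
Lemma full_lpp_tail n sig x y l (A : seq bool -> seq bool -> seq bool -> bool) :
  0 < sig -> sig <= 1 ->
  (forall us vs ws, A us vs ws -> 0 <= (x + y) * (l - (full_lpp n us vs ws)%:R)) ->
  bexp (nseq n (oddsp (sig * expR x))) (fun us =>
    bexp (nseq n (oddsp (sig * expR y))) (fun vs =>
    bexp (nseq (n * n) (sig ^+ 2)) (fun ws => (A us vs ws)%:R)))
  <= expR ((x + y) * l) * (mgf_factor sig x ^+ n * mgf_factor sig y ^+ n).
Proof.
move=> s0 s1 HA; rewrite -full_lpp_mgf_exp // -bexpZ.
have pe z : probs (nseq n (oddsp (sig * expR z))).
  by apply/probs_nseq/oddsp01; rewrite mulr_ge0 ?ltW ?expR_gt0.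
apply: le_bexp => // us _; rewrite -bexpZ; apply: le_bexp => // vs _.
rewrite -bexpZ; apply: le_bexp => [|ws _].
  by apply: probs_nseq; rewrite sqr_ge0 /= expr_le1 // ltW.
rewrite -expRD; case E: (A us vs ws) => /=; last exact: expR_ge0.
apply: le_trans (expR_ge1Dx _); have := HA _ _ _ E; lra.
Qed.

End ExponentialMoment.

(** * Separation of the two sides; the comparison walk *)

Section ExitSide.
Context {R : realType}.
Implicit Types (a b w x y l sig t c r : R) (us vs ws : seq bool).

Let probs_odds n sig x : 0 < sig -> probs (nseq n (oddsp (sig * expR x))).
Proof.
by move=> s0; apply/probs_nseq/oddsp01; rewrite mulr_ge0 ?ltW ?expR_gt0.
Qed.

Let probs_bulk n sig : 0 < sig -> sig <= 1 -> probs (nseq n (sig ^+ 2)).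
Proof. by move=> s0 s1; apply: probs_nseq; rewrite sqr_ge0 /= expr_le1 // ltW. Qed.

(** Adding a right boundary can only increase the last-passage time, so its parameter [y] may be
    chosen freely in the range. *)
Lemma top_lpp_upper_tail n sig x y t l : 0 < sig -> sig <= 1 -> n%:R * sig <= t ->
  0 <= x <= 1 / 4 -> 0 <= y <= 1 / 4 ->
  bexp (nseq n (oddsp (sig * expR (- x)))) (fun us =>
    bexp (nseq (n * n) (sig ^+ 2)) (fun ws => (l <= (top_lpp n us ws)%:R)%R%:R))
  <= expR (t * (2 * (x + y) + 2 / 5 * (x ^+ 3 + y ^+ 3)) - (x + y) * l).
Proof.
move=> s0 s1 hn hx hy; have [x0 _] := andP hx; have [y0 _] := andP hy.
have t0 : 0 <= t by apply: le_trans hn; rewrite mulr_ge0 // ltW.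
pose A us vs ws := l <= (full_lpp n us vs ws)%:R.
have HA us vs ws : A us vs ws -> 0 <= (- x + - y) * (l - (full_lpp n us vs ws)%:R).
  by rewrite /A => h; rewrite -opprD -mulrNN !opprK opprB mulr_ge0; lra.
apply: le_trans (_ : expR ((- x + - y) * l) *
    (mgf_factor sig (- x) ^+ n * mgf_factor sig (- y) ^+ n) <= _).
  apply: le_trans (full_lpp_tail n sig (- x) (- y) l A s0 s1 HA).
  apply: le_bexp; first exact: probs_odds.
  move=> us _; rewrite -[leLHS](bexp_cst (nseq n (oddsp (sig * expR (- y))))).
  apply: le_bexp; first exact: probs_odds.
  move=> vs _; apply: le_bexp; first exact: probs_bulk.
  move=> ws _; rewrite ler_nat /A full_lpp_max.
  case E: (l <= _) => //=; rewrite (le_trans E) // ler_nat; exact: leq_maxl.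
apply: le_trans (_ : expR ((- x + - y) * l) * (expR (t * sh x) * expR (t * sh y)) <= _).
  apply: ler_wpM2l; first exact: expR_ge0.
  have e0 z : 0 <= mgf_factor sig z ^+ n by rewrite exprn_ge0 // ltW // mgf_factor_gt0.
  by apply: ler_pM; [exact: e0|exact: e0|exact: mgf_factorN_le|exact: mgf_factorN_le].
rewrite -!expRD ler_expR.
have [_ hx'] := ch_sh_le _ hx; have [_ hy'] := ch_sh_le _ hy.
have := ler_wpM2l t0 hx'; have := ler_wpM2l t0 hy'; lra.
Qed.

(** With an auxiliary top boundary of parameter [- (x / 2)], the full time is the maximum of both
    one-sided times, so [right_lpp < l] forces [full_lpp < l] or [l <= top_lpp]. Each case has its
    own exponential bound. *)
Lemma right_lpp_lower_tail n sig x t t' l : 0 < sig -> sig <= 1 -> n%:R * sig <= t ->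
  0 <= x <= 1 / 4 -> 0 <= t' -> t' <= n%:R * (sig / (1 + sig * expR x)) ->
  bexp (nseq n (oddsp (sig * expR x))) (fun vs =>
    bexp (nseq (n * n) (sig ^+ 2)) (fun ws => ((right_lpp n vs ws)%:R < l)%R%:R))
  <= expR (x / 2 * l + t * (x + x ^+ 3 / 20) - t' * (2 * x + x ^+ 3 / 3)) +
     expR (t * (2 * x + x ^+ 3 / 10) - x * l).
Proof.
move=> s0 s1 hn hx t'0 ht'; have [x0 x1] := andP hx.
have hx2 : 0 <= x / 2 <= 1 / 4 by lra.
have t0 : 0 <= t by apply: le_trans hn; rewrite mulr_ge0 // ltW.
pose A us vs ws := (full_lpp n us vs ws)%:R < l.
have HA us vs ws : A us vs ws -> 0 <= (- (x / 2) + x) * (l - (full_lpp n us vs ws)%:R).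
  by rewrite /A => h; rewrite mulr_ge0; lra.
have T1 := full_lpp_tail n sig (- (x / 2)) x l A s0 s1 HA.
have T2 := top_lpp_upper_tail n sig (x / 2) (x / 2) t l s0 s1 hn hx2 hx2.
apply: le_trans (_ : _ <= expR ((- (x / 2) + x) * l) *
    (mgf_factor sig (- (x / 2)) ^+ n * mgf_factor sig x ^+ n) + _) _; last first.
  apply: lerD; last by apply: le_trans T2 _; rewrite ler_expR; lra.
  apply: le_trans (_ : expR ((- (x / 2) + x) * l) *
      (expR (t * sh (x / 2)) * expR (- (t' * sh x))) <= _).
    apply: ler_wpM2l; first exact: expR_ge0.
    have e0 z : 0 <= mgf_factor sig z ^+ n by rewrite exprn_ge0 // ltW // mgf_factor_gt0.
    apply: ler_pM; [exact: e0|exact: e0| |exact: mgf_factor_expn_le].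
    by apply: mgf_factorN_le => //; lra.
  rewrite -!expRD ler_expR.
  have [_ hx'] := ch_sh_le _ hx2; have hy' := sh_ge _ x0.
  have := ler_wpM2l t0 hx'; have := ler_wpM2l t'0 hy'; lra.
apply: le_trans (lerD T1 (lexx _)).
have -> : bexp (nseq n (oddsp (sig * expR (- (x / 2))))) (fun us =>
    bexp (nseq (n * n) (sig ^+ 2)) (fun ws => (l <= (top_lpp n us ws)%:R)%R%:R)) =
  bexp (nseq n (oddsp (sig * expR (- (x / 2))))) (fun us =>
    bexp (nseq n (oddsp (sig * expR x))) (fun vs =>
    bexp (nseq (n * n) (sig ^+ 2)) (fun ws => (l <= (top_lpp n us ws)%:R)%R%:R))) :> R.
  by apply: eq_bexp => us _; rewrite bexp_cst.
rewrite -bexpD -[leLHS](bexp_cst (nseq n (oddsp (sig * expR (- (x / 2)))))).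
apply: le_bexp; first exact: probs_odds.
move=> us _; rewrite -bexpD; apply: le_bexp; first exact: probs_odds.
move=> vs _; rewrite -bexpD; apply: le_bexp; first exact: probs_bulk.
move=> ws _; rewrite /A full_lpp_max -natrD ler_nat.
case: (ltP (right_lpp n vs ws)%:R l) => //= h.
case: (leP l (top_lpp n us ws)%:R) => //= h'; first by rewrite addn1.
by rewrite /maxn; case: ifP => _; rewrite ?h ?h'.
Qed.

(* At the threshold [2 t + (2/5) r^2 t^(1/3)], which lies strictly between the
   typical values of the two one-sided last-passage times, all the exponents
   are negative multiples of [r^3]. *)
Lemma exit_side n sig c r (l := 2 * c ^+ 3 + 2 / 5 * r ^+ 2 * c) :
  0 < sig -> sig <= 1 -> n%:R * sig <= c ^+ 3 -> 0 < c -> 0 < r -> r / c <= 1 / 4 ->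
  r ^+ 3 / 30 <= c ^+ 3 ->
  c ^+ 3 - r ^+ 3 / 30 <= n%:R * (sig / (1 + sig * expR (r / c))) ->
  bexp (nseq n (oddsp (sig * expR (- (r / c))))) (fun us =>
    bexp (nseq (n * n) (sig ^+ 2)) (fun ws => (l <= (top_lpp n us ws)%:R)%R%:R)) +
  bexp (nseq n (oddsp (sig * expR (r / c)))) (fun vs =>
    bexp (nseq (n * n) (sig ^+ 2)) (fun ws => ((right_lpp n vs ws)%:R < l)%R%:R))
  <= 3 * expR (- (r ^+ 3 / 20)).
Proof.
move=> s0 s1 hn c0 r0 hx hrc ht'.
have x0 : 0 < r / c by rewrite divr_gt0.
have hx1 : 0 <= r / c <= 1 / 4 by lra.
have hx2 : 0 <= r / c / 2 <= 1 / 4 by lra.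
have cn : c != 0 by rewrite gt_eqF.
have r3 : 0 < r ^+ 3 by rewrite exprn_gt0.
have U := top_lpp_upper_tail n sig (r / c) (r / c / 2) (c ^+ 3) l s0 s1 hn hx1 hx2.
have LL := right_lpp_lower_tail n sig (r / c) (c ^+ 3) (c ^+ 3 - r ^+ 3 / 30) l
  s0 s1 hn hx1.
apply: le_trans (lerD U (LL _ ht')) _; first by lra.
have -> : 3 * expR (- (r ^+ 3 / 20)) = expR (- (r ^+ 3 / 20)) +
  (expR (- (r ^+ 3 / 20)) + expR (- (r ^+ 3 / 20))) by ring.
apply: lerD; [|apply: lerD]; rewrite ler_expR.
- suff -> : c ^+ 3 * (2 * (r / c + r / c / 2) + 2 / 5 * ((r / c) ^+ 3 + (r / c / 2) ^+ 3)) -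
    (r / c + r / c / 2) * l = - (3 / 20) * r ^+ 3 by lra.
  by rewrite /l; field.
(* Replacing [c ^+ 3] by [c ^+ 3 - r ^+ 3 / 30] costs at most [r ^+ 3 / 30], because
   [r / c <= 1 / 4]; and [1 / 12 - 1 / 30 = 1 / 20]. *)
- have : (r / c) ^+ 3 <= r / c * (1 / 4) ^+ 2.
    rewrite exprS; apply: ler_wpM2l; first exact: ltW.
    by apply: lerXn2r; rewrite ?nnegrE; lra.
  suff : r / c / 2 * l + c ^+ 3 * (r / c + (r / c) ^+ 3 / 20) -
    (c ^+ 3) * (2 * (r / c) + (r / c) ^+ 3 / 3) = - (1 / 12) * r ^+ 3.
    by nra.
  by rewrite /l; field.
- suff -> : c ^+ 3 * (2 * (r / c) + (r / c) ^+ 3 / 10) - r / c * l = - (3 / 10) * r ^+ 3.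
    by lra.
  by rewrite /l; field.
Qed.

End ExitSide.

(** * The comparison walk and the exit event on the grid *)

Section Walk.
Context {R : realType}.
Implicit Types (x p q l theta rho : R) (ss bs us vs ws : seq bool).

Definition walk_hits K (x : R) ss bs :=
  has (fun k => x + (pcount bs k)%:R <= (pcount ss k)%:R) (iota 0 K.+1).

Lemma walk_hits_cons K x s b ss bs : 0 < x ->
  walk_hits K.+1 x (s :: ss) (b :: bs) = walk_hits K (x + b%:R - s%:R) ss bs.
Proof.
move=> x0; rewrite /walk_hits -[K.+2]/(1 + K.+1)%N iotaD -[(0 + 1)%N]/(1 + 0)%N.
rewrite iotaDl has_cat has_map.
rewrite [X in X || _](_ : _ = false); last first.
  by rewrite /= /pcount !take0 /= addr0 (lt_geF x0).
rewrite orFb; apply: eq_has => k; rewrite /pcount /= !natrD; apply/idP/idP; lra.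
Qed.

(** For the walk [S_k = pcount ss k - pcount bs k], the process [expR (theta * S_k) / rho ^+ k] is a
    supermartingale. Its maximal inequality is obtained by conditioning on the first step; at levels
    [x <= 0] the right-hand side is at least [1]. *)
Lemma walk_hits_le n K x p q theta rho : (K <= n)%N ->
  0 <= p <= 1 -> 0 <= q <= 1 -> 0 <= theta -> 1 <= rho ->
  (1 + p * (expR theta - 1)) * (1 + q * (expR (- theta) - 1)) <= rho ->
  bexp (nseq n p) (fun ss => bexp (nseq n q) (fun bs => (walk_hits K x ss bs)%:R))
  <= rho ^+ K * expR (- (theta * x)).
Proof.
move=> Kn p01 q01 th0 rho1 hrho; elim: K n x Kn => [|K IH] n x Kn.
  have [x0|x0] := lerP x 0.
    rewrite expr0 mul1r (le_trans (y := 1)) //.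
      rewrite -[leRHS](bexp_cst (nseq n p)); apply: le_bexp; first exact: probs_nseq.
      move=> ss _; rewrite -[leRHS](bexp_cst (nseq n q)).
      apply: le_bexp; first exact: probs_nseq.
      by move=> bs _; rewrite lern1 leq_b1.
    by rewrite -[leLHS]expR0 ler_expR -mulrN mulr_ge0 // oppr_ge0.
  rewrite (le_trans (y := 0)) //; last by rewrite mulr_ge0 ?exprn_ge0 ?expR_ge0; lra.
  rewrite -(bexp_cst (nseq n p) 0); apply: le_bexp; first exact: probs_nseq.
  move=> ss _; rewrite -(bexp_cst (nseq n q) 0).
  apply: le_bexp; first exact: probs_nseq.
  by move=> bs _; rewrite /walk_hits /= /pcount !take0 /= addr0 (lt_geF x0).
have [x0|x0] := lerP x 0.
  rewrite (le_trans (y := 1)) //.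
    rewrite -[leRHS](bexp_cst (nseq n p)); apply: le_bexp; first exact: probs_nseq.
    move=> ss _; rewrite -[leRHS](bexp_cst (nseq n q)).
    apply: le_bexp; first exact: probs_nseq.
    by move=> bs _; rewrite lern1 leq_b1.
  rewrite -[leLHS](mulr1 1); apply: ler_pM => //; first exact: exprn_ege1.
  by rewrite -[leLHS]expR0 ler_expR -mulrN mulr_ge0 // oppr_ge0.
case: n Kn => // n Kn.
pose V y := bexp (nseq n p) (fun ss => bexp (nseq n q) (fun bs => (walk_hits K y ss bs)%:R)).
have HV y : V y <= rho ^+ K * expR (- (theta * y)) by exact: IH.
rewrite [leLHS]/= !bexpD !bexpZ.
have E s b : bexp (nseq n p) (fun ss => bexp (nseq n q) (fun bs =>
    (walk_hits K.+1 x (s :: ss) (b :: bs))%:R)) = V (x + b%:R - s%:R).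
  by apply: eq_bexp => ss _; apply: eq_bexp => bs _; rewrite walk_hits_cons.
rewrite !E.
have -> : rho ^+ K.+1 * expR (- (theta * x)) = rho * (rho ^+ K * expR (- (theta * x))).
  by rewrite exprS mulrA.
set Z := rho ^+ K * expR (- (theta * x)).
have Z0 : 0 <= Z by rewrite mulr_ge0 ?exprn_ge0 ?expR_ge0; lra.
have V11 : V (x + true%:R - true%:R) <= Z by apply: le_trans (HV _) _; rewrite addrK.
have V10 : V (x + false%:R - true%:R) <= Z * expR theta.
  apply: le_trans (HV _) _; rewrite /Z -mulrA -expRD.
  by apply: ler_wpM2l; [rewrite exprn_ge0 //; lra|rewrite ler_expR /=; lra].
have V01 : V (x + true%:R - false%:R) <= Z * expR (- theta).
  apply: le_trans (HV _) _; rewrite /Z -mulrA -expRD.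
  by apply: ler_wpM2l; [rewrite exprn_ge0 //; lra|rewrite ler_expR /=; lra].
have V00 : V (x + false%:R - false%:R) <= Z.
  by apply: le_trans (HV _) _; rewrite addrK.
have [p0 p1] := andP p01; have [q0 q1] := andP q01.
have p1' : 0 <= 1 - p by lra.
have q1' : 0 <= 1 - q by lra.
apply: le_trans (ler_wpM2r Z0 hrho).
have -> : (1 + p * (expR theta - 1)) * (1 + q * (expR (- theta) - 1)) * Z =
  p * (q * Z + (1 - q) * (Z * expR theta)) + (1 - p) * (q * (Z * expR (- theta)) + (1 - q) * Z).
  have := expRxMexpNx_1 theta; move: (expR theta) (expR (- theta)) => e e' ee.
  have -> : (1 + p * (e - 1)) * (1 + q * (e' - 1)) * Z =
    (1 - p) * (1 - q) * Z + p * (1 - q) * (Z * e) + (1 - p) * q * (Z * e') +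
    p * q * (e * e') * Z by ring.
  by rewrite ee; ring.
by apply: lerD; apply: ler_wpM2l => //; apply: lerD; apply: ler_wpM2l.
Qed.

(** Column [n - k] of the array corresponds to [z = k * d], and [pcount ss k] to the sources in the
    [k] leftmost strips. *)
Definition disc_exit n K (x : R) ss ws :=
  has (fun k : nat => x + (lpp (fun=> 0%N) (fun=> 0%N) (flatW n ws) n n)%:R <=
     (pcount ss k + lpp (fun=> 0%N) (fun=> 0%N) (flatW n ws) n (n - k))%:R) (iota 0 K.+1).

(** If both conditions on [l] fail, the full time at the corner equals the right-sided one, while at
    column [n - k] it is at least the right-sided one. So the last [k] stationary increments are at
    most the right-sided increment, which [lpp_hincr_le] bounds by the increment without
    boundary. *)
Lemma disc_exit_cases n K x l ss us vs ws : size us = n -> size vs = n -> (K <= n)%N ->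
  disc_exit n K x ss ws ->
  [|| walk_hits K x ss (rev (hrun n us vs ws).1), l <= (top_lpp n us ws)%:R |
      (right_lpp n vs ws)%:R < l].
Proof.
move=> su sv Kn; case: ltP; rewrite ?orbT // => hr; case: leP; rewrite ?orbT // => ht.
rewrite !orbF => /hasP[k hk hD]; apply/hasP; exists k => //.
have kn : (k <= n)%N by move: hk; rewrite mem_iota; lia.
have tr : (top_lpp n us ws <= right_lpp n vs ws)%N.
  by rewrite -(ler_nat R) ltW // (lt_le_trans ht).
have p0 u : pcount u 0 = 0%N by rewrite /pcount take0.
have F := full_lpp_top n us vs ws k su sv kn.
rewrite full_lpp_max (maxn_idPr tr) in F.
have Fk := lpp_max (pcount us) (pcount vs) (flatW n ws) n (n - k).
have hv j : (0 + pcount vs j <= pcount vs j.+1 + 0)%N by rewrite pcountS; lia.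
have H := lpp_hincr_le (fun=> 0%N) (fun=> 0%N) (pcount vs) (flatW n ws) erefl
  (esym (p0 vs)) hv n (n - k) k.
rewrite subnK // /right_lpp in F H.
have {}Fk := Fk (p0 us) (p0 vs).
move: hD.
set G := lpp (fun=> 0%N) (fun=> 0%N) _ n n in H *.
set G' := lpp (fun=> 0%N) (fun=> 0%N) _ n (n - k) in H *.
set B := pcount (rev _) k in F *.
have : (B + G' <= G)%N by lia.
rewrite -(ler_nat R) !natrD; lra.
Qed.

End Walk.

(** * The estimate on the grid *)

Section DiscreteBound.
Context {R : realType}.
Implicit Types (sig x y l p c r d eps L : R) (ss us vs ws : seq bool).

(** Auxiliary stationary boundaries are added to the same weights. By Burke's property the outgoing
    edge is i.i.d. and independent of the sources, so the three cases of [disc_exit_cases] can be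
    summed. *)
Lemma disc_exit_le n K sig x y l p : 0 < sig -> sig <= 1 -> 0 <= p <= 1 -> (K <= n)%N ->
  bexp (nseq n p) (fun ss => bexp (nseq (n * n) (sig ^+ 2)) (fun ws =>
    (disc_exit n K x ss ws)%:R)) <=
  bexp (nseq n p) (fun ss => bexp (nseq n (oddsp (sig * expR (- y)))) (fun bs =>
    (walk_hits K x ss bs)%:R)) +
  (bexp (nseq n (oddsp (sig * expR (- y)))) (fun us =>
    bexp (nseq (n * n) (sig ^+ 2)) (fun ws => (l <= (top_lpp n us ws)%:R)%R%:R)) +
   bexp (nseq n (oddsp (sig * expR y))) (fun vs =>
    bexp (nseq (n * n) (sig ^+ 2)) (fun ws => ((right_lpp n vs ws)%:R < l)%R%:R))).
Proof.
move=> s0 s1 p01 Kn.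
set a := oddsp (sig * expR (- y)); set b := oddsp (sig * expR y); set w := sig ^+ 2.
have pr z : probs (nseq n (oddsp (sig * expR z))).
  by apply/probs_nseq/oddsp01; rewrite mulr_ge0 ?ltW ?expR_gt0.
have pw : probs (nseq (n * n) w).
  by apply: probs_nseq; rewrite sqr_ge0 /= expr_le1 // ltW.
have pp : probs (nseq n p) by exact: probs_nseq.
have burke : a * b = (1 - a) * (1 - b) * w.
  have d z : 1 + sig * expR z != 0.
    by rewrite gt_eqF //; apply: addr_gt0 => //; apply: mulr_gt0 => //; exact: expR_gt0.
  have -> : a * b = sig ^+ 2 * (expR y * expR (- y)) /
      ((1 + sig * expR y) * (1 + sig * expR (- y))).
    by rewrite /a /b /oddsp; field; rewrite !d.
  by rewrite expRxMexpNx_1 mulr1 /a /b /oddsp /w; field; rewrite !d.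
set U := bexp (nseq n a) (fun us => bexp (nseq (n * n) w)
  (fun ws => (l <= (top_lpp n us ws)%:R)%R%:R)).
set V := bexp (nseq n b) _.
have -> : U = bexp (nseq n a) (fun us => bexp (nseq n b) (fun vs =>
    bexp (nseq (n * n) w) (fun ws => (l <= (top_lpp n us ws)%:R)%R%:R))).
  by apply: eq_bexp => us _; rewrite bexp_cst.
have -> : V = bexp (nseq n a) (fun us => bexp (nseq n b) (fun vs =>
    bexp (nseq (n * n) w) (fun ws => ((right_lpp n vs ws)%:R < l)%R%:R))).
  by rewrite bexp_cst.
rewrite -[X in _ <= _ + X](bexp_cst (nseq n p)) -[leRHS]bexpD.
apply: le_bexp => // ss _.
have -> : bexp (nseq n a) (fun bs => (walk_hits K x ss bs)%:R) =
  bexp (nseq n a) (fun us => bexp (nseq n b) (fun vs => bexp (nseq (n * n) w) (fun ws =>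
    (walk_hits K x ss (rev (hrun n us vs ws).1))%:R))) :> R.
  rewrite (hrun_burke a b w burke n n (fun us _ => (walk_hits K x ss (rev us))%:R)).
  by rewrite [LHS]bexp_rev_nseq; apply: eq_bexp => us _; rewrite bexp_cst.
rewrite -!bexpD -[leLHS](bexp_cst (nseq n a)).
apply: le_bexp; first exact: pr.
move=> us; rewrite size_nseq => su; rewrite -!bexpD -[leLHS](bexp_cst (nseq n b)).
apply: le_bexp; first exact: pr.
move=> vs; rewrite size_nseq => sv; rewrite -!bexpD.
apply: le_bexp => // ws _; rewrite -!natrD ler_nat.
case E : (disc_exit n K x ss ws) => //.
by have /or3P[->|->|->] := disc_exit_cases n K x l ss us vs ws su sv Kn E; lia.
Qed.

(** [sig ^+ 2] is the probability that a cell of area [d ^+ 2] is occupied; [sig] agrees with [d] to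
    first order. *)
Lemma sqrt_cell d (sig := Num.sqrt (1 - expR (- d ^+ 2))) : 0 < d -> d <= 1 ->
  [/\ 0 < sig, sig <= 1, sig ^+ 2 = 1 - expR (- d ^+ 2), sig <= d & d <= sig * (1 + d)].
Proof.
move=> d0 d1; have d2 : 0 < d ^+ 2 by rewrite exprn_gt0.
have e1 : expR (- d ^+ 2) < 1 by rewrite expR_lt1 oppr_lt0.
have s2 : sig ^+ 2 = 1 - expR (- d ^+ 2) by rewrite sqr_sqrtr //; lra.
have s0 : 0 < sig by rewrite sqrtr_gt0; lra.
have sd : sig <= d.
  rewrite -(ler_pXn2r (n := 2)) ?nnegrE ?(ltW s0) ?(ltW d0) // s2.
  by have := expR_ge1Dx (- d ^+ 2); lra.
split => //; first exact: le_trans sd d1.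
rewrite -(ler_pXn2r (n := 2)) ?nnegrE ?(ltW d0) //; last by apply: mulr_ge0; lra.
rewrite exprMn s2; have := expR_ge1Dx (d ^+ 2); have := expRxMexpNx_1 (d ^+ 2).
have := expR_gt0 (- d ^+ 2); set e := expR (- d ^+ 2) in e1 *; set f := expR (d ^+ 2).
move=> e0 fe hf.
have h : e * (1 + d ^+ 2) <= 1 by rewrite -[leRHS]fe [f * e]mulrC ler_pM2l.
have : (1 - e) * (1 + d ^+ 2) <= (1 - e) * (1 + d) ^+ 2.
  by apply: ler_wpM2l; [lra|rewrite sqrrD expr1n mul1r; lra].
by lra.
Qed.

(** With [e = expR theta] and [lam = expR (- theta)], the logarithm is at most [d] times [(e + lam -
    2) + (1 - lam) ^+ 2 + 2 * d * (1 - lam)]; each term is of order [theta ^+ 2], as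
    [2 * d <= theta]. *)
Lemma walk_mgf_le d sig theta (p := 1 - expR (- d)) (q := oddsp (sig * expR (- theta))) :
  0 < d -> d <= sig * (1 + d) -> 0 < sig -> sig <= d -> 2 * d <= theta -> theta <= 1 / 4 ->
  (1 + p * (expR theta - 1)) * (1 + q * (expR (- theta) - 1)) <= expR (4 * d * theta ^+ 2).
Proof.
move=> d0 ds s0 sd dth th.
have th0 : 0 < theta by lra.
have pd : p <= d by rewrite /p; have := expR_ge1Dx (- d); lra.
have p0 : 0 <= p by rewrite subr_ge0 expR_le1; lra.
have hth : 0 <= theta <= 1 / 4 by lra.
have [ch _] := ch_sh_le _ hth.
have l0 := expR_ge1Dx (- theta); set lam := expR (- theta) in l0 ch q *.
have lam1 : lam <= 1 by rewrite /lam expR_le1; lra.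
have e1 := expR_ge1Dx theta; set e := expR theta in e1 ch *.
have lam0 : 0 < lam by exact: expR_gt0.
have den : 0 < 1 + sig * lam by apply: addr_gt0 => //; apply: mulr_gt0.
have q01 : 0 <= q <= 1 by apply: oddsp01; rewrite mulr_ge0 ?ltW.
have hq : d * (lam - 2 * d) <= q.
  rewrite /q /oddsp ler_pdivlMr //.
  have [h|h] := lerP (lam - 2 * d) 0.
    apply: le_trans (_ : 0 <= _); last by rewrite mulr_ge0 ?ltW.
    by apply: mulr_le0_ge0; [apply: mulr_ge0_le0|]; rewrite // ltW.
  apply: le_trans (_ : sig * (1 + d) * ((lam - 2 * d) * (1 + sig * lam)) <= _).
    by rewrite -[leLHS]mulrA; apply: ler_wpM2r => //; rewrite mulr_ge0 ?ltW.
  rewrite -mulrA; apply: ler_wpM2l; first exact: ltW.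
  apply: le_trans (_ : (1 + d) * ((lam - 2 * d) * (1 + d)) <= _); last by nra.
  apply: ler_wpM2l; first by lra.
  apply: ler_wpM2l; first exact: ltW.
  by rewrite lerD2l -[leRHS]mulr1; apply: ler_pM => //; exact: ltW.
rewrite (le_trans (y := expR (p * (e - 1)) * expR (q * (lam - 1)))) //.
  apply: ler_pM; rewrite ?expR_ge1Dx //; [|].
    by apply: addr_ge0 => //; apply: mulr_ge0 => //; lra.
  by nra.
rewrite -expRD ler_expR.
have : p * (e - 1) <= d * (e - 1) by apply: ler_wpM2r; lra.
have : d * (lam - 2 * d) * (1 - lam) <= q * (1 - lam) by apply: ler_wpM2r; lra.
suff : e - 1 - (lam - 2 * d) * (1 - lam) <= 4 * theta ^+ 2 by nra.
have : (1 - lam + 2 * d) * (1 - lam) <= (theta + theta) * theta.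
  by apply: ler_pM; lra.
by lra.
Qed.

(** [c] stands for [t^(1/3)] and [d] for the mesh. With [theta = r / c], the moments of [K] steps
    contribute at most [4 * eps * r ^+ 2 = r * L / 4] to the exponent, and the level takes away at
    least [r * L / 2]; what remains is [- L ^+ 2 / (64 * eps)]. *)
Lemma disc_exit_bound n K eps L c (r := L / (16 * eps)) (d := c ^+ 3 / n%:R)
    (sig := Num.sqrt (1 - expR (- d ^+ 2))) :
  0 < eps -> 0 < L -> (0 < n)%N -> 0 < c -> 4 * r <= c -> 2 <= L * c ->
  d <= 1 -> 90 * d * c ^+ 3 <= r ^+ 3 -> 2 * d <= r / c ->
  (K <= n)%N -> K%:R * d <= eps * c ^+ 2 ->
  bexp (nseq n (1 - expR (- d))) (fun ss => bexp (nseq (n * n) (sig ^+ 2)) (fun ws =>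
    (disc_exit n K (L * c - 1) ss ws)%:R)) <=
  expR (- (L ^+ 2 / (64 * eps))) + 3 * expR (- (r ^+ 3 / 20)).
Proof.
move=> e0 L0 n0 c0 rc Lc d1 hd1 hd2 Kn hK.
have nR : 0 < n%:R :> R by rewrite ltr0n.
have d0 : 0 < d by rewrite divr_gt0 ?exprn_gt0.
have [s0 s1 _ sd ds] := sqrt_cell d d0 d1; rewrite -/sig in s0 s1 sd ds.
have r0 : 0 < r by rewrite divr_gt0 // mulr_gt0.
have x0 : 0 < r / c by rewrite divr_gt0.
have x1 : r / c <= 1 / 4 by rewrite ler_pdivrMr //; lra.
have nd : n%:R * d = c ^+ 3 by rewrite /d mulrC divfK // gt_eqF.
have p01 : 0 <= 1 - expR (- d) <= 1.
  have := expR_ge0 (- d); have : expR (- d) <= 1 by rewrite expR_le1; lra.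
  by move=> ? ?; apply/andP; split; lra.
have r3 : 0 < r ^+ 3 by rewrite exprn_gt0.
have c3 : 0 < c ^+ 3 by rewrite exprn_gt0.
apply: le_trans (disc_exit_le n K sig (L * c - 1) (r / c)
  (2 * c ^+ 3 + 2 / 5 * r ^+ 2 * c) _ s0 s1 p01 Kn) _.
apply: lerD; last first.
  apply: exit_side => //.
  - by rewrite -nd; apply: ler_wpM2l => //; exact: ltW.
  - have : r ^+ 3 <= c ^+ 3 by apply: lerXn2r; rewrite ?nnegrE; lra.
    by lra.
  - have ex : expR (r / c) <= 2.
      have := expR_ge1Dx (- (r / c)); have := expRxMexpNx_1 (r / c).
      by have := expR_gt0 (r / c); nra.
    (* [sig >= d / (1 + d)], [sig <= d] and [expR (r / c) <= 2] give the factor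
       [1 / ((1 + d) * (1 + 2 * d)) >= 1 - 3 * d]. The loss [3 * d * c ^+ 3] is at most
       [r ^+ 3 / 30] by hypothesis. *)
    apply: le_trans (_ : n%:R * (d * (1 - 3 * d)) <= _).
      by rewrite mulrA nd; lra.
    apply: ler_wpM2l; first exact: ltW.
    have ep := expR_gt0 (r / c).
    rewrite ler_pdivlMr; last by apply: addr_gt0 => //; apply: mulr_gt0.
    have [h|h] := lerP (1 - 3 * d) 0.
      apply: le_trans (_ : 0 <= _); last exact: ltW.
      apply: mulr_le0_ge0; first by apply: mulr_ge0_le0 => //; exact: ltW.
      by apply: addr_ge0 => //; apply: mulr_ge0; exact: ltW.
    apply: le_trans (_ : d * (1 - 3 * d) * (1 + d * 2) <= _).
      apply: ler_wpM2l; first by apply: mulr_ge0; exact: ltW.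
      by rewrite lerD2l; apply: ler_pM => //; exact: ltW.
    apply: le_trans (_ : sig * (1 + d) * ((1 - 3 * d) * (1 + d * 2)) <= _).
      rewrite -[leLHS]mulrA; apply: ler_wpM2r => //.
      by apply: mulr_ge0; lra.
    rewrite -mulrA -[leRHS]mulr1; apply: ler_wpM2l; first exact: ltW.
    have : 0 <= d ^+ 2 by exact: sqr_ge0.
    have : 0 <= d ^+ 3 by apply: exprn_ge0; exact: ltW.
    by lra.
have rho1 : 1 <= expR (4 * d * (r / c) ^+ 2).
  by apply: le_trans (expR_ge1Dx _); rewrite lerDl mulr_ge0 ?sqr_ge0 //; lra.
have q01 : 0 <= oddsp (sig * expR (- (r / c))) <= 1.
  by apply: oddsp01; rewrite mulr_ge0 ?expR_ge0 ?ltW.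
apply: le_trans (walk_hits_le n K (L * c - 1) _ _ (r / c) _ Kn p01 q01 (ltW x0) rho1
   (walk_mgf_le d sig (r / c) d0 ds s0 sd hd2 x1)) _.
rewrite -expRM_natl -expRD ler_expR.
have cn : c != 0 by rewrite gt_eqF.
have en : eps != 0 by rewrite gt_eqF.
have : K%:R * (4 * d * (r / c) ^+ 2) <= r * L / 4.
  apply: le_trans (_ : eps * c ^+ 2 * (4 * (r / c) ^+ 2) <= _).
    have -> : K%:R * (4 * d * (r / c) ^+ 2) = K%:R * d * (4 * (r / c) ^+ 2) by ring.
    by apply: ler_wpM2r => //; rewrite mulr_ge0 ?sqr_ge0.
  by rewrite le_eqVlt; apply/orP; left; apply/eqP; rewrite /r; field; rewrite cn en.
have : r * L / 2 <= r / c * (L * c - 1).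
  have -> : r / c * (L * c - 1) = r * L - r / c by field.
  have : r / c <= r * L / 2.
    rewrite -mulrA; apply: ler_wpM2l; first exact: ltW.
    by rewrite -[c^-1]mul1r ler_pdivrMr //; lra.
  by lra.
have -> : L ^+ 2 / (64 * eps) = r * L / 4 by rewrite /r; field.
by lra.
Qed.

Lemma expRN_le_cube (A : R) : 0 < A -> expR (- A) <= 6 / A ^+ 3.
Proof.
move=> A0; have A3 : 0 < A ^+ 3 by rewrite exprn_gt0.
rewrite expRN -[6]invrK -invfM lef_pV2 ?posrE ?expR_gt0 ?mulr_gt0 ?invr_gt0 //.
by have := expR_ge1Dxn 2 (ltW A0); rewrite (_ : 3`! = 6)%N //; lra.
Qed.

Lemma expRN_le_inv (A : R) : 0 < A -> expR (- A) <= A^-1.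
Proof.
move=> A0; rewrite expRN lef_pV2 ?posrE ?expR_gt0 //.
by have := expR_ge1Dx A; lra.
Qed.

End DiscreteBound.

(** * From point configurations to grids *)

Section Discretisation.
Context {R : realType}.
Implicit Types (t d z x : R) (S : set (R * R)) (X : set R).

(* Strips are numbered from the right (from the top), so that last-passage
   times to the corner [(t, t)] are computed by [lpp] started at that corner. *)
Definition strip t d i : set R := `]t - i.+1%:R * d, t - i%:R * d].

Definition at_most_one {T : Type} (A : set T) := forall p q, A p -> A q -> p = q.

Lemma stripE t d i x : strip t d i x = (t - i.+1%:R * d < x <= t - i%:R * d) :> Prop.
Proof. by rewrite /strip /= in_itv. Qed.

Lemma strip_exists t d n x : t - n%:R * d < x <= t -> exists2 i, (i < n)%N & strip t d i x.
Proof.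
elim: n => [|n IH] /andP[h1 h2]; first by move: h1; rewrite mul0r subr0 ltNge h2.
have [h|h] := lerP x (t - n%:R * d); first by exists n => //; rewrite stripE h1 h.
by have [|i hi hx] := IH; [rewrite h h2|exists i => //; exact: ltnW].
Qed.

Lemma strip_gt_ltn t d i m x : 0 < d -> strip t d i x -> t - m%:R * d < x -> (i < m)%N.
Proof.
move=> d0; rewrite stripE => /andP[_ h1] h2.
have : t - m%:R * d < t - i%:R * d by exact: lt_le_trans h2 h1.
by rewrite ltrD2l ltrN2 ltr_pM2r // ltr_nat.
Qed.

Section Chains.
Variables (t d : R) (n : nat) (S : set (R * R)) (W : nat -> nat -> bool).
Hypothesis d0 : 0 < d.
Hypothesis nd : n%:R * d = t.
Hypothesis WP : forall i j, (i < n)%N -> (j < n)%N ->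
  reflect (exists p, [/\ S p, strip t d i p.1 & strip t d j p.2]) (W i j).
Let G := lpp (fun=> 0%N) (fun=> 0%N) W.
Let ne (p q : R * R) := (p.1 < q.1) && (p.2 < q.2).

(** Follow the maximum in the recursion: a diagonal step through an occupied cell prepends one of
    its points, which lies strictly below and to the left of the chain built so far. *)
Lemma chain_of_lpp j i : (j <= n)%N -> (i <= n)%N -> exists s : seq (R * R),
  [/\ size s = G j i, sorted ne s & forall p, p \in s ->
     [/\ S p, t - i%:R * d < p.1 <= t & t - j%:R * d < p.2 <= t]].
Proof.
move: j i; apply: lpp_ind => [i _ _|j _ _|i j IH1 IH2 IH3 hj hi]; [by exists [::]..|].
have le m m' : (m <= m')%N -> t - m'%:R * d <= t - m%:R * d.
  by move=> h; rewrite lerD2l lerN2 ler_pM2r // ler_nat.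
have [s1 [h1 c1 H1]] := IH1 hj (ltnW hi).
have [s2 [h2 c2 H2]] := IH2 (ltnW hj) hi.
have [s3 [h3 c3 H3]] := IH3 (ltnW hj) (ltnW hi).
rewrite /G lppS -/G.
have [E|] := eqVneq (maxn (maxn (G j.+1 i) (G j i.+1)) (G j i + W i j)) (G j.+1 i).
  exists s1; split; rewrite ?h1 ?E // => p /H1[Sp /andP[a1 a2] a3]; split => //.
  by rewrite a2 andbT (le_lt_trans (le _ _ (leqnSn i))).
move=> E1; have [E|E2] := eqVneq (maxn (maxn (G j.+1 i) (G j i.+1)) (G j i + W i j)) (G j i.+1).
  exists s2; split; rewrite ?h2 ?E // => p /H2[Sp a3 /andP[a1 a2]]; split => //.
  by rewrite a2 andbT (le_lt_trans (le _ _ (leqnSn j))).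
have E : maxn (maxn (G j.+1 i) (G j i.+1)) (G j i + W i j) = (G j i + W i j)%N.
  by move: E1 E2; lia.
rewrite E; case: (WP i j hi hj) => [[p [Sp sp1 sp2]]|_]; last first.
  exists s3; split; rewrite ?h3 ?addn0 // => p /H3[Sp /andP[a1 a2] /andP[a3 a4]].
  by split => //; rewrite ?a2 ?a4 andbT; apply: le_lt_trans (le _ _ (leqnSn _)) _.
move: sp1 sp2; rewrite !stripE => /andP[b1 b2] /andP[b3 b4].
exists (p :: s3); split; first by rewrite /= h3 addn1.
- case: s3 c3 H3 {h3} => //= q s3 -> H3; rewrite andbT.
  have [_ /andP[a1 _] /andP[a2 _]] := H3 q (mem_head _ _).
  by rewrite /ne (le_lt_trans b2 a1) (le_lt_trans b4 a2).
move=> q; rewrite inE => /orP[/eqP ->|/H3[Sq /andP[a1 a2] /andP[a3 a4]]].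
  split => //; rewrite ?b1 ?b3 /=.
    by apply: (le_trans b2); have := le _ _ (leq0n i); rewrite mul0r subr0.
  by apply: (le_trans b4); have := le _ _ (leq0n j); rewrite mul0r subr0.
by split => //; rewrite ?a2 ?a4 andbT; apply: le_lt_trans (le _ _ (leqnSn _)) _.
Qed.

Lemma A_t_ge : ((G n n)%:R%:E <= A_t S t 0)%E.
Proof.
have [s [hs cs Hs]] := chain_of_lpp n n (leqnn n) (leqnn n).
apply: ereal_sup_ubound; exists s; last by rewrite hs.
split => // p /Hs[Sp]; rewrite nd subrr => a1 a2; split => //=.
Qed.

Hypothesis col1 : forall i, (i < n)%N ->
  at_most_one (S `&` (strip t d i `*` `]0, t])).
Hypothesis row1 : forall j, (j < n)%N ->
  at_most_one (S `&` (`]0, t] `*` strip t d j)).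

(** With at most one point per row and column, the points after [p] leave both strips of [p]; so
    [G j' i'] bounds the tail and the cell of [p] adds one. *)
Lemma size_chain_le (s : seq (R * R)) j i : (j <= n)%N -> (i <= n)%N -> sorted ne s ->
  (forall p, p \in s -> [/\ S p, 0 < p.1 <= t, 0 < p.2 <= t,
     t - i%:R * d < p.1 & t - j%:R * d < p.2]) -> (size s <= G j i)%N.
Proof.
elim: s j i => // p s IH j i hj hi /= cs Hs.
have [Sp p1 p2 p1i p2j] := Hs p (mem_head _ _).
have [i' i'n si'] := strip_exists t d n p.1 ltac:(by rewrite nd subrr).
have [j' j'n sj'] := strip_exists t d n p.2 ltac:(by rewrite nd subrr).
have i'i := strip_gt_ltn _ _ _ _ _ d0 si' p1i.
have j'j := strip_gt_ltn _ _ _ _ _ d0 sj' p2j.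
have netr : transitive ne.
  by move=> a b c /andP[h1 h2] /andP[h3 h4]; rewrite /ne (lt_trans h1 h3) (lt_trans h2 h4).
have minp := order_path_min netr cs.
have IHs : (size s <= G j' i')%N.
  apply: IH; rewrite ?(ltnW i'n) ?(ltnW j'n) //; first exact: path_sorted cs.
  move=> q qs; have [Sq q1 q2 _ _] := Hs q (mem_behead (s := p :: s) qs).
  have /andP[pq1 pq2] := allP minp q qs.
  move: (si') (sj'); rewrite !stripE => /andP[b1 b2] /andP[b3 b4].
  split => //; rewrite ltNge; apply/negP => h.
    have E : p = q.
      apply: (col1 i' i'n); split => //; split => //=; rewrite ?in_itv //= ?p2 ?q2 //.
      by rewrite stripE h andbT (lt_trans b1 pq1).
    by rewrite E ltxx in pq1.
  have E : p = q.
    apply: (row1 j' j'n); split => //; split => //=; rewrite ?in_itv //= ?p1 ?q1 //.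
    by rewrite stripE h andbT (lt_trans b3 pq2).
  by rewrite E ltxx in pq2.
have Wij : W i' j' by apply/WP => //; exists p.
have h1 : (G j'.+1 i'.+1 <= G j i)%N.
  rewrite -(subnKC i'i) -(subnKC j'j); apply: leq_trans (lpp_mono _ _ _ _ _ _ _) _.
    by move=> ? ?.
  exact: (lpp_mono_row (fun=> 0%N)).
by apply: leq_trans h1; rewrite /G lppS -/G Wij; move: IHs; lia.
Qed.

Lemma A_t_le k z : (k <= n)%N -> k%:R * d <= z -> (A_t S t z <= (G n (n - k))%:R%:E)%E.
Proof.
move=> kn kz; apply: ge_ereal_sup => _ [s [Hs cs] <-].
rewrite lee_fin ler_nat; apply: size_chain_le => //; first exact: leq_subr.
move=> p /Hs[Sp /= [/andP[a1 a2] /andP[a3 a4]]].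
have z0 : 0 <= z by apply: le_trans kz; rewrite mulr_ge0 // ltW.
split; rewrite ?a2 ?a3 ?a4 ?andbT ?(le_lt_trans z0) //.
  by apply: le_lt_trans a1; apply: le_trans kz; rewrite natrB // mulrBl nd; lra.
by rewrite nd subrr.
Qed.

End Chains.

Lemma npts_le_size {T : choiceType} (A : set T) (l : seq T) :
  (forall x : T, A x -> x \in l) -> (npts A <= (size l)%:R%:E :> \bar R)%E.
Proof.
move=> Al; have fA : finite_set A.
  by apply: (sub_finite_set (B := [set` l])) => //; exact: finite_seq.
rewrite /npts; case: pselect => [fA'|/(_ fA)//]; rewrite lee_fin ler_nat.
apply: uniq_leq_size; first exact: fset_uniq.
by move=> x; rewrite in_fset_set // inE => /Al.
Qed.

(** Each full strip contributes at most its bit, and the strip that [z] may cut accounts for the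
    [+ 1]. Bits are read from the left, hence the index [n - i.+1]. *)
Lemma N_src_le t d n X (ss : seq bool) k z : 0 < d -> n%:R * d = t -> (k < n)%N ->
  z <= k.+1%:R * d ->
  (forall i, (i < n)%N -> at_most_one (X `&` strip t d i)) ->
  (forall i x, (i < n)%N -> X x -> strip t d i x -> nth false ss (n - i.+1)) ->
  (N_src X z <= (pcount ss k + 1)%:R%:E)%E.
Proof.
move=> d0 nd kn zk one bit.
have H m : (m <= n)%N -> exists2 l : seq R, (size l <= pcount ss m)%N &
    forall x, X x -> 0 < x <= m%:R * d -> x \in l.
  elim: m => [|m IH] mn.
    by exists [::] => // x _; rewrite mul0r => /andP[h1 /(lt_le_trans h1)]; rewrite ltxx.
  have [l sl hl] := IH (ltnW mn).
  have inm : (n - m.+1 < n)%N by lia.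
  have st x : m%:R * d < x -> x <= m.+1%:R * d -> strip t d (n - m.+1) x.
    move=> h1 h2; rewrite stripE -nd subnSK // !natrB // ?(ltnW mn) // -!mulrBl.
    by apply/andP; split; lra.
  have [[y [Xy sy]]|nex] := pselect (exists y, X y /\ strip t d (n - m.+1) y).
    exists (y :: l).
      rewrite /= pcountS; have := bit _ _ inm Xy sy.
      by rewrite subnSK // subKn ?(ltnW mn) // => ->; rewrite addn1.
    move=> x Xx /andP[x0 xm]; rewrite inE; have [xm'|xm'] := lerP x (m%:R * d).
      by rewrite hl ?orbT // x0.
    by apply/orP; left; apply/eqP; apply: (one _ inm); split => //; exact: st.
  exists l; first by rewrite pcountS; lia.
  move=> x Xx /andP[x0 xm]; have [xm'|xm'] := lerP x (m%:R * d).
    by rewrite hl ?x0.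
  by exfalso; apply: nex; exists x; split => //; exact: st.
have [l sl hl] := H k.+1 kn.
apply: le_trans (npts_le_size _ l _) _.
  by move=> x [Xx /= /andP[x0 xz]]; apply: hl => //; rewrite x0 (le_trans xz).
by rewrite lee_fin ler_nat (leq_trans sl) // pcountS leq_add2l leq_b1.
Qed.

(** For [k] the integer part of [z / d], sources are counted up to [k.+1%:R * d] and points from
    [k%:R * d] on. This rounding costs at most one source, which explains the level [L * c - 1]. *)
Lemma exit_disc_exit {Ω : Type} (alpha : Ω -> set (R * R)) (sources : Ω -> set R)
    L eps c d n K w ss ws :
  0 < d -> 0 < c -> n%:R * d = c ^+ 3 -> (K < n)%N -> eps * c ^+ 2 < K.+1%:R * d ->
  (forall i j, (i < n)%N -> (j < n)%N -> reflect (exists p, [/\ alpha w p,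
     strip (c ^+ 3) d i p.1 & strip (c ^+ 3) d j p.2]) (nth false ws (j * n + i))) ->
  (forall i, (i < n)%N -> at_most_one (alpha w `&` (strip (c ^+ 3) d i `*` `]0, c ^+ 3]))) ->
  (forall j, (j < n)%N -> at_most_one (alpha w `&` (`]0, c ^+ 3] `*` strip (c ^+ 3) d j))) ->
  (forall i, (i < n)%N -> at_most_one (sources w `&` strip (c ^+ 3) d i)) ->
  (forall i x, (i < n)%N -> sources w x -> strip (c ^+ 3) d i x ->
     nth false ss (n - i.+1)) ->
  exit_event alpha sources L eps (c ^+ 3) w -> disc_exit n K (L * c - 1) ss ws.
Proof.
move=> d0 c0 nd Kn hK WP col1 row1 one bit.
have c3 : 0 <= c ^+ 3 by rewrite exprn_ge0 // ltW.
have p13 : (c ^+ 3) `^ (1 / 3) = c.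
  by rewrite -powR_mulrn ?ltW // -powRrM mul1r divff ?pnatr_eq0 // powRr1 // ltW.
have p23 : (c ^+ 3) `^ (2 / 3) = c ^+ 2.
  rewrite -powR_mulrn ?ltW // -powRrM mulrCA divff ?pnatr_eq0 // mulr1 powR_mulrn //.
  exact: ltW.
rewrite /exit_event /= p13 p23.
have WP' i j : (i < n)%N -> (j < n)%N -> reflect (exists p, [/\ alpha w p,
     strip (c ^+ 3) d i p.1 & strip (c ^+ 3) d j p.2]) (flatW n ws i j) by exact: WP.
set G := lpp (fun=> 0%N) (fun=> 0%N) (flatW n ws).
have A0 : A_t (alpha w) (c ^+ 3) 0 = (G n n)%:R%:E.
  apply/eqP; rewrite eq_le; apply/andP; split.
    have := @A_t_le _ _ _ _ _ d0 nd WP' col1 row1 0 0 (leq0n n).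
    by rewrite subn0 mul0r; apply.
  exact: (@A_t_ge _ _ _ _ _ d0 nd WP').
(* The supremum over the continuum of [z] is dominated by a maximum over finitely many [k], attained
   at [k0]. *)
pose f (k : 'I_K.+1) := (pcount ss k + 1 + G n (n - k))%N.
have [k0 _ hk0] := @arg_maxnP _ ord0 predT f isT.
have sup_le : (ereal_sup [set (N_src (sources w) z + A_t (alpha w) (c ^+ 3) z)%E
     | z in [set z | (0 <= z <= eps * c ^+ 2)%R]] <= (f k0)%:R%:E)%E.
  apply: ge_ereal_sup => _ [z /= /andP[z0 z1] <-].
  have zd0 : 0 <= z / d by rewrite divr_ge0 // ltW.
  pose k := Num.truncn (z / d).
  have /andP[k1 k2] : k%:R <= z / d < k.+1%:R := truncn_itv zd0.
  have kz : k%:R * d <= z by rewrite -ler_pdivlMr.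
  have zk : z <= k.+1%:R * d by rewrite -ler_pdivrMr // ltW.
  have kK : (k < K.+1)%N.
    by rewrite -(ltr_nat R) (le_lt_trans k1) // ltr_pdivrMr // (le_lt_trans z1).
  have kn : (k < n)%N by apply: leq_ltn_trans Kn.
  apply: le_trans (leeD (N_src_le _ _ _ _ _ _ _ d0 nd kn zk one bit)
     (@A_t_le _ _ _ _ _ d0 nd WP' col1 row1 k z (ltnW kn) kz)) _.
  rewrite -EFinD lee_fin -natrD ler_nat; exact: (hk0 (Ordinal kK)).
rewrite A0 => hL.
have {}hL : ((L * c)%:E <= (f k0)%:R%:E - (G n n)%:R%:E)%E.
  by apply: le_trans hL _; exact: leeD2r.
rewrite -EFinB lee_fin in hL.
apply/hasP; exists (k0 : nat); first by rewrite mem_iota /=.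
by move: hL; rewrite /f -/G !natrD; lra.
Qed.

End Discretisation.

(** * Poisson processes seen on a grid *)

Section BitsLaw.
Context {R : realType} {d : measure_display} {Ω : measurableType d} {I : eqType}.
Variables (P : probability Ω R) (ev : I -> set Ω) (q : I -> R) (idx : seq I).
Hypothesis mev : forall i, i \in idx -> measurable (ev i).
Hypothesis indep : forall J, uniq J -> {subset J <= idx} ->
  P [set w | forall i, i \in J -> ev i w] = (\prod_(i <- J) q i)%:E.

Definition bits (l : seq I) (w : Ω) : seq bool := [seq `[< ~ ev i w >] | i <- l].

Let measurable_all (J : seq I) : {subset J <= idx} ->
  measurable [set w | forall i, i \in J -> ev i w].
Proof.
elim: J => [|i J IH] hJ.
  by rewrite (_ : [set w | _] = setT) //; apply/seteqP; split.
rewrite (_ : [set w | _] = ev i `&` [set w | forall i, i \in J -> ev i w]).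
  apply: measurableI; first by apply: mev; apply: hJ; rewrite mem_head.
  by apply: IH => j hj; apply: hJ; rewrite inE hj orbT.
apply/seteqP; split=> w /=.
  by move=> h; split=> [|j hj]; apply: h; rewrite inE ?eqxx // hj orbT.
by move=> [h1 h2] j; rewrite inE => /orP[/eqP ->|/h2].
Qed.

(** Inclusion-exclusion: void probabilities determine the joint law of the bits. Indices in [J] are
    already required void; a bit [true] at [i] is the event without condition at [i] minus the one
    where [i] has moved to [J]. *)
Lemma bits_law_gen (l J : seq I) (F : seq bool -> bool) : uniq (l ++ J) -> {subset l ++ J <= idx} ->
  let E := [set w | (forall i, i \in J -> ev i w) /\ F (bits l w)] in
  measurable E /\
  P E = ((\prod_(i <- J) q i) * bexp [seq 1 - q i | i <- l] (fun s => (F s)%:R))%:E.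
Proof.
elim: l J F => [|i l IH] J F ul sl /=.
  case: (F [::]).
    rewrite (_ : [set w | _] = [set w | forall i, i \in J -> ev i w]).
      by split; [exact: measurable_all|rewrite indep // mulr1].
    by apply/seteqP; split=> w /=; [case|].
  rewrite (_ : [set w | _] = set0); first by rewrite measure0 mulr0.
  by apply/seteqP; split=> w //= [].
have u2 : uniq (l ++ i :: J).
  by rewrite (perm_uniq (s2 := i :: l ++ J)) // -[i :: J]cat1s perm_catCA.
have s2 : {subset l ++ i :: J <= idx}.
  move=> j hj; apply: sl; move: hj; rewrite /= !(mem_cat, inE).
  by move=> /orP[|/orP[]] ->; rewrite ?orbT.
have u1 : uniq (l ++ J) by case/andP: ul.
have s1 : {subset l ++ J <= idx} by move=> j hj; apply: sl; rewrite inE hj orbT.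
have [m1 P1] := IH (i :: J) (fun s => F (false :: s)) u2 s2.
have [m2 P2] := IH J (fun s => F (true :: s)) u1 s1.
have [m3 P3] := IH (i :: J) (fun s => F (true :: s)) u2 s2.
set E1 := [set w | _] in m1 P1; set E2 := [set w | _] in m2 P2.
set E3 := [set w | _] in m3 P3.
have -> : [set w | (forall j, j \in J -> ev j w) /\ F (`[< ~ ev i w >] :: bits l w)] =
    E1 `|` (E2 `\` E3).
  apply/seteqP; split=> w /=.
    move=> [hJ hF]; have [h|h] := pselect (ev i w).
      left; rewrite asboolF in hF; last by move/(_ h).
      by split => // j; rewrite inE => /orP[/eqP ->|/hJ].
    right; rewrite asboolT // in hF; split => // -[h1 _].
    by apply: h; apply: h1; rewrite mem_head.
  move=> [[h1 h2]|[[h1 h2] h3]].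
    split; first by move=> j hj; apply: h1; rewrite inE hj orbT.
    by rewrite asboolF // => h; apply: h; apply: h1; rewrite mem_head.
  split => //; rewrite asboolT // => h; apply: h3; split => //.
  by move=> j; rewrite inE => /orP[/eqP ->|/h1].
have mD : measurable (E2 `\` E3) by exact: measurableD.
split; first exact: measurableU.
rewrite measureU //; last first.
  apply/seteqP; split=> w //= [[h1 _] [[h2 h3] h4]]; apply: h4; split => //.
have E23 : E2 `&` E3 = E3.
  apply/seteqP; split=> w; first by case.
  move=> [h1 h2]; split; split => // j hj.
  by apply: h1; rewrite inE hj orbT.
have PD : P (E2 `\` E3) = (P E2 - P E3)%E.
  by rewrite -[in RHS]E23; apply: measureD => //; rewrite -ge0_fin_numE ?fin_num_measure.
rewrite [X in (X + _)%E]P1 [X in (_ + X)%E]PD P2 P3 -EFinB -EFinD !big_cons.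
by congr (_%:E); ring.
Qed.

Lemma bits_law (F : seq bool -> bool) : uniq idx ->
  let E := [set w | F (bits idx w)] in
  measurable E /\ P E = (bexp [seq 1 - q i | i <- idx] (fun s => (F s)%:R))%:E.
Proof.
move=> u /=; have [] := bits_law_gen idx [::] F; rewrite ?cats0 //.
rewrite big_nil mul1r (_ : [set w | _ /\ _] = [set w | F (bits idx w)]) //.
by apply/seteqP; split=> w /= => [[]|].
Qed.

End BitsLaw.

(** * Poisson processes: multiple points and void probabilities *)

Section PoissonFacts.
Context {R : realType}.

Lemma npts_eq0 {T : choiceType} (A : set T) : npts A = 0%:R%:E :> \bar R <-> A = set0.
Proof.
rewrite /npts; split=> [|->]; last first.
  by case: pselect => [f|/(_ (finite_set0 T))//]; rewrite fset_set0 cardfs0.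
case: pselect => // f [] /eqP; rewrite pnatr_eq0 cardfs_eq0 => /eqP.
exact: fset_set_set0.
Qed.

Lemma npts_eq1 {T : choiceType} (A : set T) : npts A = 1%:R%:E :> \bar R -> at_most_one A.
Proof.
rewrite /npts; case: pselect => // f [] /eqP; rewrite eqr_nat => /cardfs1P[x E] p p' Ap Ap'.
have h y : A y -> y = x.
  by move=> Ay; apply/eqP; rewrite -in_fset1 -E in_fset_set // inE.
by rewrite (h p) // (h p').
Qed.

Context {d dT dT' : measure_display} {Ω : measurableType d} {T : measurableType dT}
  {T' : measurableType dT'}.
Variable P : probability Ω R.

(** The bound is [1 - (1 + m) * expR (- m) <= m ^+ 2]. The exceptional set is the complement of the
    counts [0] and [1], hence measurable, and it includes infinite counts. *)
Lemma poisson_multiple (mu : set T -> \bar R) D X B (m : R) :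
  poisson_pp P mu D X -> measurable B -> B `<=` D -> mu B = m%:E -> 0 <= m ->
  exists E : set Ω, [/\ measurable E, (P E <= (m ^+ 2)%:E)%E &
    forall w, ~ E w -> at_most_one (X w `&` B)].
Proof.
move=> [_ H _] mB BD muB m0.
have fin : (mu B < +oo)%E by rewrite muB ltry.
have [m0' P0] := H B mB BD fin 0%N; have [m1' P1] := H B mB BD fin 1%N.
set E0 := [set w | _] in m0' P0; set E1 := [set w | _] in m1' P1.
have mU : measurable (E0 `|` E1) by exact: measurableU.
exists (~` (E0 `|` E1)); split; first exact: measurableC.
  rewrite probability_setC // measureU //; last first.
    apply/seteqP; split=> w // [e0]; rewrite /E1 /= e0 => -[] /eqP.
    by rewrite eqr_nat.
  rewrite [X in (_ - (X + _))%E]P0 [X in (_ - (_ + X))%E]P1 muB -EFinD lee_fin /=.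
  rewrite expr0 expr1 fact0 (_ : 1`! = 1)%N //.
  rewrite mulr1 !divr1.
  have := expR_ge1Dx (- m); have := expR_gt0 (- m); nra.
move=> w /contrapT[/npts_eq0 ->|/npts_eq1//].
by move=> ? ? [].
Qed.

Lemma measure_cells (mu : {measure set T -> \bar R}) (I : eqType)
    (B : I -> set T) (m : R) (J : seq I) :
  uniq J -> (forall i, i \in J -> measurable (B i)) ->
  (forall i, i \in J -> mu (B i) = m%:E) ->
  (forall i j, i \in J -> j \in J -> i <> j -> B i `&` B j = set0) ->
  let U := [set x | exists2 i, i \in J & B i x] in
  measurable U /\ mu U = ((size J)%:R * m)%:E.
Proof.
elim: J => [|i J IH] uJ mB muB dB /=.
  rewrite (_ : [set x | _] = set0); first by rewrite measure0 mul0r.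
  by apply/seteqP; split=> x // [].
have [|j hj|j hj|j k hj hk|mU muU] := IH; first by case/andP: uJ.
- by apply: mB; rewrite inE hj orbT.
- by apply: muB; rewrite inE hj orbT.
- by apply: dB; rewrite inE ?hj ?hk orbT.
have -> : [set x | exists2 j, j \in i :: J & B j x] =
    B i `|` [set x | exists2 j, j \in J & B j x].
  apply/seteqP; split=> x /=.
    by move=> [j]; rewrite inE => /orP[/eqP ->|hj hx]; [left|right; exists j].
  by move=> [hx|[j hj hx]]; [exists i; rewrite ?mem_head|exists j => //; rewrite inE hj orbT].
have mBi : measurable (B i) by apply: mB; rewrite mem_head.
split; first exact: measurableU.
rewrite measureU //; last first.
  apply/seteqP; split=> x // [hi [j hj hx]].
  rewrite -(dB i j) ?mem_head ?inE ?hj ?orbT // => ij.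
  by case/andP: uJ; rewrite ij hj.
by rewrite [X in (_ + X)%E]muU [X in (X + _)%E]muB ?mem_head // -EFinD -natr1 mulrDl mul1r addrC.
Qed.

Lemma poisson_void (mu : set T -> \bar R) (mu' : set T' -> \bar R) D D'
    (X : Ω -> set T) (X' : Ω -> set T') {d''} {T'' : measurableType d''}
    (X'' : Ω -> set T'') U V (u v : R) :
  poisson_pp P mu D X -> poisson_pp P mu' D' X' -> indep3 P X X' X'' ->
  measurable U -> measurable V -> U `<=` D -> V `<=` D' ->
  mu U = u%:E -> mu' V = v%:E ->
  P [set w | X w `&` U = set0 /\ X' w `&` V = set0] = (expR (- u) * expR (- v))%:E.
Proof.
move=> [_ H _] [_ H' _] ind mU mV UD VD' muU muV.
have [_ P0] := H U mU UD ltac:(by rewrite muU ltry) 0%N.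
have [_ P0'] := H' V mV VD' ltac:(by rewrite muV ltry) 0%N.
have disj (S : Type) (A : set S) : pairwise_disjoint [:: A] by move=> [|i] [|j].
have mB (e : measure_display) (S : measurableType e) (A : set S) :
    measurable A -> forall B, B \in [:: A] -> measurable B.
  by move=> mA B; rewrite inE => /eqP ->.
have := ind [:: U] [:: V] [::] (mB _ _ _ mU) (disj _ _) (mB _ _ _ mV) (disj _ _)
  ltac:(by []) ltac:(by move=> [|i] [|j]) [:: 0%N; 0%N] erefl.
rewrite /= !big_ord_recl big_ord0 /= mule1 P0 P0' muU muV /= !expr0 fact0 !mulr1 !divr1.
rewrite -EFinM => <-; congr (P _); apply/seteqP; split=> w /=.
  by move=> [h1 h2] [|[|i]] //= _; apply/npts_eq0.
by move=> h; split; apply/npts_eq0; [exact: (h 0%N)|exact: (h 1%N)].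
Qed.

End PoissonFacts.

Lemma union_bound {R : realType} {d : measure_display} {Ω : measurableType d}
    (P : probability Ω R) n (G : nat -> Ω -> Prop) (m : R) :
  (forall i, (i < n)%N -> exists E : set Ω, [/\ measurable E, (P E <= m%:E)%E &
     forall w, ~ E w -> G i w]) ->
  exists E : set Ω, [/\ measurable E, (P E <= (n%:R * m)%:E)%E &
     forall w, ~ E w -> forall i, (i < n)%N -> G i w].
Proof.
elim: n => [|n IH] H.
  by exists set0; split => //; rewrite measure0 mul0r.
have [|E [mE PE GE]] := IH; first by move=> i hi; apply: H; exact: ltnW.
have [E' [mE' PE' GE']] := H n (ltnSn n).
exists (E `|` E'); split; first exact: measurableU.
  apply: le_trans (measureU2 _ mE mE') _.
  by rewrite -natr1 mulrDl mul1r EFinD; exact: leeD.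
move=> w /= nE i; rewrite ltnS leq_eqVlt => /orP[/eqP ->|hi].
  by apply: GE' => h; apply: nE; right.
by apply: GE => // h; apply: nE; left.
Qed.

Lemma lebesgue_rect {R : realType} (A B : set (measurableTypeR R)) (a b : R) :
  measurable A -> measurable B ->
  lebesgue_measure A = a%:E -> lebesgue_measure B = b%:E ->
  ((@lebesgue_measure R) \x (@lebesgue_measure R))%E (A `*` B) = (a * b)%:E.
Proof.
move=> mA mB hA hB; rewrite product_measure1E //.
exact: (f_equal2 mule hA hB).
Qed.

(** * Coupling of the Poisson processes with a Bernoulli array *)

Section Coupling.
Context {R : realType} {dO : measure_display} {Ω : measurableType dO}.
Variables (P : probability Ω R) (alpha : Ω -> set (R * R)) (sources sinks : Ω -> set R).
Hypothesis alphaP : poisson_pp P ((@lebesgue_measure R) \x (@lebesgue_measure R))%E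
  [set p | 0 < p.1 /\ 0 < p.2] alpha.
Hypothesis sourcesP : poisson_pp P (@lebesgue_measure R) [set x | 0 < x] sources.
Hypothesis indP : indep3 P alpha sources sinks.
Variables (t d : R) (n : nat).
Hypothesis d0 : 0 < d.
Hypothesis nd : n%:R * d = t.

Let t0 : 0 <= t.
Proof. by rewrite -nd mulr_ge0 // ltW. Qed.

Let strip_pos i : (i < n)%N -> strip t d i `<=` [set x | 0 < x].
Proof.
move=> hi x; rewrite stripE => /andP[h _]; apply: le_lt_trans h.
by rewrite -nd -mulrBl mulr_ge0 ?(ltW d0) // subr_ge0 ler_nat.
Qed.

Let measurable_strip i : measurable (strip t d i).
Proof. exact: measurable_itv. Qed.

Let lebesgue_strip i : lebesgue_measure (strip t d i) = d%:E :> \bar R.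
Proof.
rewrite /strip lebesgue_measure_itv /= lte_fin ifT; last first.
  by rewrite ltrD2l ltrN2 ltr_pM2r // ltr_nat.
by rewrite -EFinB -natr1; congr (_%:E); ring.
Qed.

Let lebesgue_0t : lebesgue_measure (`]0, t]%classic : set R) = t%:E :> \bar R.
Proof.
rewrite lebesgue_measure_itv /= lte_fin; case: ltP => h; first by rewrite sube0.
by congr (_%:E); apply/eqP; rewrite eq_le t0 h.
Qed.

(** Union bound over [n] columns and [n] rows of area [t * d] and [n] source strips of length [d],
    with [n * d = t]. *)
Lemma good_event : exists E : set Ω, [/\ measurable E,
  (P E <= ((2 * t ^+ 2 + 1) * t * d)%:E)%E &
  forall w, ~ E w -> [/\
    forall i, (i < n)%N -> at_most_one (alpha w `&` (strip t d i `*` `]0, t])),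
    forall j, (j < n)%N -> at_most_one (alpha w `&` (`]0, t] `*` strip t d j)) &
    forall i, (i < n)%N -> at_most_one (sources w `&` strip t d i)]].
Proof.
have m0t : measurable (`]0, t]%classic : set R) by exact: measurable_itv.
have [i hi|E1 [mE1 PE1 GE1]] := @union_bound _ _ _ P n
   (fun i w => at_most_one (alpha w `&` (strip t d i `*` `]0, t]))) ((t * d) ^+ 2).
  apply: (poisson_multiple _ _ _ _ _ _ alphaP); last by rewrite mulr_ge0 // ltW.
  - exact: (measurableX (measurable_strip i) m0t).
  - move=> [x y] /= [/(strip_pos _ hi) /= x0]; rewrite in_itv /= => /andP[y0 _].
    by split.
  - rewrite mulrC.
    exact: (lebesgue_rect _ _ _ _ (measurable_strip i) m0t (lebesgue_strip i) lebesgue_0t).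
have [i hi|E2 [mE2 PE2 GE2]] := @union_bound _ _ _ P n
   (fun j w => at_most_one (alpha w `&` (`]0, t] `*` strip t d j))) ((t * d) ^+ 2).
  apply: (poisson_multiple _ _ _ _ _ _ alphaP); last by rewrite mulr_ge0 // ltW.
  - exact: (measurableX m0t (measurable_strip i)).
  - move=> [x y] /= []; rewrite in_itv /= => /andP[x0 _] /(strip_pos _ hi) /= y0.
    by split.
  - exact: (lebesgue_rect _ _ _ _ m0t (measurable_strip i) lebesgue_0t (lebesgue_strip i)).
have [i hi|E3 [mE3 PE3 GE3]] := @union_bound _ _ _ P n
   (fun i w => at_most_one (sources w `&` strip t d i)) (d ^+ 2).
  apply: (poisson_multiple _ _ _ _ _ _ sourcesP).
  - exact: measurable_strip.
  - exact: strip_pos.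
  - exact: lebesgue_strip.
  - exact: ltW.
have m12 : measurable (E1 `|` E2) by exact: measurableU.
exists (E1 `|` E2 `|` E3); split; first exact: measurableU.
  apply: le_trans (measureU2 _ m12 mE3) _.
  apply: le_trans (leeD (measureU2 _ mE1 mE2) (lexx _)) _.
  apply: le_trans (leeD (leeD PE1 PE2) PE3) _.
  by rewrite -!EFinD lee_fin -nd; lra.
move=> w /= nE; split.
- by apply: GE1 => h; apply: nE; left; left.
- by apply: GE2 => h; apply: nE; left; right.
- by apply: GE3 => h; apply: nE; right.
Qed.

Let cell (c : nat * nat) : set (R * R) := strip t d c.1 `*` strip t d c.2.

Definition cell_empty (i : (nat * nat) + nat) : set Ω :=
  match i with
  | inl c => [set w | alpha w `&` cell c = set0]
  | inr k => [set w | sources w `&` strip t d (n - k.+1) = set0]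
  end.

Definition cell_prob (i : (nat * nat) + nat) : R :=
  match i with inl _ => expR (- d ^+ 2) | inr _ => expR (- d) end.

(** Cells are listed row by row, so that the bit of cell [(i, j)] stands at [j * n + i] as in
    [flatW]; the source strips follow, from left to right. *)
Definition cell_idx : seq ((nat * nat) + nat) :=
  [seq inl ((k %% n)%N, (k %/ n)%N) | k <- iota 0 (n * n)] ++ [seq inr k | k <- iota 0 n].

Let cell_idxP i : i \in cell_idx ->
  match i with inl c => (c.1 < n)%N && (c.2 < n)%N | inr k => (k < n)%N end.
Proof.
rewrite mem_cat => /orP[] /mapP[k]; rewrite mem_iota /= => hk -> //=.
by rewrite ltn_mod ltn_divLR // ?hk ?andbT; case: (n) hk => // ; rewrite muln0.
Qed.

Let uniq_cell_idx : uniq cell_idx.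
Proof.
rewrite cat_uniq !map_inj_in_uniq ?iota_uniq ?andbT /=.
- by apply/hasPn => _ /mapP[k _ ->]; apply/negP => /mapP[].
- by move=> k k' _ _ [].
- move=> k k' _ _ [h1 h2].
  by rewrite (divn_eq k n) (divn_eq k' n) h1 h2.
Qed.

Let strip_inj i j x : strip t d i x -> strip t d j x -> i = j.
Proof.
have h i' j' : strip t d i' x -> strip t d j' x -> (i' <= j')%N.
  move=> h1 h2; rewrite -ltnS; apply: (strip_gt_ltn _ _ _ _ _ d0 h1).
  by move: h2; rewrite stripE => /andP[].
by move=> h1 h2; apply/eqP; rewrite eqn_leq !h.
Qed.

Let cell_facts c : (c.1 < n)%N && (c.2 < n)%N -> [/\ measurable (cell c),
  cell c `<=` [set p | 0 < p.1 /\ 0 < p.2] &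
  ((@lebesgue_measure R) \x (@lebesgue_measure R))%E (cell c) = (d ^+ 2)%:E].
Proof.
move=> /andP[c1 c2]; split.
  exact: (measurableX (measurable_strip c.1) (measurable_strip c.2)).
  by move=> [x y] [/(strip_pos _ c1) /= x0 /(strip_pos _ c2) /= y0]; split.
exact: (lebesgue_rect _ _ _ _ (measurable_strip c.1) (measurable_strip c.2)
  (lebesgue_strip c.1) (lebesgue_strip c.2)).
Qed.

Lemma measurable_cell_empty i : i \in cell_idx -> measurable (cell_empty i).
Proof.
move=> /cell_idxP; case: i => [c|k] h /=.
  have [mc cD muc] := cell_facts c h.
  have [_ H _] := alphaP; have [m _] := H _ mc cD ltac:(by rewrite muc ltry) 0%N.
  rewrite (_ : [set w | _] = [set w | npts (alpha w `&` cell c) = 0%:R%:E :> \bar R]) //.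
  by apply/seteqP; split=> w /= hw; [apply/npts_eq0|exact/(@npts_eq0 R)].
have [_ H _] := sourcesP.
have hk : (n - k.+1 < n)%N by lia.
have [m _] := H _ (measurable_strip (n - k.+1)) (strip_pos _ hk)
  ltac:(by rewrite lebesgue_strip ltry) 0%N.
rewrite (_ : [set w | _] =
  [set w | npts (sources w `&` strip t d (n - k.+1)) = 0%:R%:E :> \bar R]) //.
by apply/seteqP; split=> w /= hw; [apply/npts_eq0|exact/(@npts_eq0 R)].
Qed.

Let inlo (i : (nat * nat) + nat) := if i is inl c then Some c else None.
Let inro (i : (nat * nat) + nat) := if i is inr k then Some k else None.

(** Emptiness of all listed cells is emptiness of their union, so one void probability per process
    suffices; the exponential turns total measure into the product. *)
Lemma cell_empty_indep J : uniq J -> {subset J <= cell_idx} ->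
  P [set w | forall i, i \in J -> cell_empty i w] = (\prod_(i <- J) cell_prob i)%:E.
Proof.
move=> uJ sJ; pose J1 := pmap inlo J; pose J2 := pmap inro J.
have J1P c : (c \in J1) = (inl c \in J).
  rewrite mem_pmap; apply/mapP/idP => [[[c'|k] hJ //= [->]] //|h].
  by exists (inl c).
have J2P k : (k \in J2) = (inr k \in J).
  rewrite mem_pmap; apply/mapP/idP => [[[c'|k'] hJ //= [->]] //|h].
  by exists (inr k).
have u1 : uniq J1 by apply: (pmap_uniq (g := inl)) => // -[].
have u2 : uniq J2 by apply: (pmap_uniq (g := inr)) => // -[].
have c1 c : c \in J1 -> (c.1 < n)%N && (c.2 < n)%N.
  by rewrite J1P => /sJ /cell_idxP.
have c2 k : k \in J2 -> (k < n)%N by rewrite J2P => /sJ /cell_idxP.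
have [||| mU muU] := @measure_cells _ _ _ ((@lebesgue_measure R) \x (@lebesgue_measure R))%E
  _ cell (d ^+ 2) J1 u1.
- by move=> c /c1 /cell_facts[].
- by move=> c /c1 /cell_facts[].
- move=> [i j] [i' j'] _ _ ne; apply/seteqP; split=> -[x y] // [[/= h1 h2] [/= h3 h4]].
  by exfalso; apply: ne; rewrite (strip_inj _ _ _ h1 h3) (strip_inj _ _ _ h2 h4).
have [||| mV muV] := @measure_cells _ _ _ (@lebesgue_measure R)
  _ (fun k => strip t d (n - k.+1)) d J2 u2.
- by move=> k _; exact: measurable_strip.
- by move=> k _; exact: lebesgue_strip.
- move=> k k' /c2 hk /c2 hk' ne; apply/seteqP; split=> x // [h1 h2].
  by exfalso; apply: ne; have := strip_inj _ _ _ h1 h2; lia.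
have := poisson_void P _ _ _ _ _ _ _ _ _ _ _ alphaP sourcesP indP mU mV _ _ muU muV.
rewrite (_ : [set w | _ /\ _] = [set w | forall i, i \in J -> cell_empty i w]); last first.
  apply/seteqP; split=> w /=.
    move=> [h1 h2] [c|k] hJ /=.
      rewrite -subset0 -h1 => p [a b]; split => //; exists c => //.
      by rewrite J1P.
    rewrite -subset0 -h2 => x [a b]; split => //; exists k => //.
    by rewrite J2P.
  move=> h; split; rewrite -subset0.
    move=> p [a [c hc hp]]; rewrite J1P in hc; have /= e := h _ hc.
    by have : (alpha w `&` cell c) p by []; rewrite e.
  move=> x [a [k hk hx]]; rewrite J2P in hk; have /= e := h _ hk.
  by have : (sources w `&` strip t d (n - k.+1)) x by []; rewrite e.
move=> ->.
- congr (_%:E); rewrite /J1 /J2; elim: J {uJ sJ J1 J2 J1P J2P u1 u2 c1 c2 mU muU mV muV}.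
    by rewrite big_nil /= !mul0r oppr0 expR0 mulr1.
  by move=> [c|k] J IH; rewrite big_cons -IH /= -natr1 mulrDl mul1r opprD expRD; ring.
- by move=> p [c /c1 /cell_facts[_ h _] /h].
- by move=> x [k /c2 hk]; apply: strip_pos; lia.
Qed.

Definition alpha_bits w : seq bool := take (n * n) (bits cell_empty cell_idx w).
Definition source_bits w : seq bool := drop (n * n) (bits cell_empty cell_idx w).

Let bits_cat w : bits cell_empty cell_idx w =
  [seq `[< ~ cell_empty (inl ((k %% n)%N, (k %/ n)%N)) w >] | k <- iota 0 (n * n)] ++
  [seq `[< ~ cell_empty (inr k) w >] | k <- iota 0 n].
Proof. by rewrite /bits /cell_idx map_cat -!map_comp. Qed.

Lemma alpha_bitsP w i j : (i < n)%N -> (j < n)%N ->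
  reflect (exists p, [/\ alpha w p, strip t d i p.1 & strip t d j p.2])
    (nth false (alpha_bits w) (j * n + i)).
Proof.
move=> hi hj; have hk : (j * n + i < n * n)%N by nia.
rewrite /alpha_bits bits_cat take_size_cat ?size_map ?size_iota //.
rewrite (nth_map 0%N) ?size_iota // nth_iota // add0n modnMDl modn_small //.
rewrite divnMDl ?(leq_ltn_trans _ hi) // divn_small // addn0.
apply: (iffP (asboolP _)) => [/eqP/set0P[p [ap [h1 h2]]]|[p [ap h1 h2]]].
  by exists p.
by apply/eqP/set0P; exists p; split.
Qed.

Lemma source_bits_nth w i x : (i < n)%N -> sources w x -> strip t d i x ->
  nth false (source_bits w) (n - i.+1).
Proof.
move=> hi sx hx; have hk : (n - i.+1 < n)%N by lia.
rewrite /source_bits bits_cat drop_size_cat ?size_map ?size_iota //.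
rewrite (nth_map 0%N) ?size_iota // nth_iota // add0n.
apply/asboolP; apply/eqP/set0P; exists x; split => //.
by rewrite (_ : (n - (n - i.+1).+1 = i)%N) //; lia.
Qed.

Lemma bits_prob (F : seq bool -> seq bool -> bool) :
  let E := [set w | F (source_bits w) (alpha_bits w)] in
  measurable E /\ P E = (bexp (nseq n (1 - expR (- d))) (fun ss =>
    bexp (nseq (n * n) (1 - expR (- d ^+ 2))) (fun ws => (F ss ws)%:R)))%:E.
Proof.
have [mE PE] := bits_law P _ cell_prob _ measurable_cell_empty cell_empty_indep
  (fun s => F (drop (n * n) s) (take (n * n) s)) uniq_cell_idx.
split => //; apply: (etrans PE); congr (_%:E).
have -> : [seq 1 - cell_prob i | i <- cell_idx] =
    nseq (n * n) (1 - expR (- d ^+ 2)) ++ nseq n (1 - expR (- d)).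
  have map_cst (f : nat -> R) x m : (forall k, f k = x) ->
      [seq f k | k <- iota 0 m] = nseq m x.
    by move=> fx; rewrite -[in RHS](size_iota 0 m); elim: (iota 0 m) => //= k s ->; rewrite fx.
  by rewrite map_cat -!map_comp; congr (_ ++ _); apply: map_cst.
rewrite bexp_cat bexp_exchange; apply: eq_bexp => ss _; apply: eq_bexp => ws.
by rewrite size_nseq => sw; rewrite take_size_cat // drop_size_cat.
Qed.

End Coupling.

(** * Assembly of the bounds and choice of the mesh *)

Lemma outer_exit_le {R : realType} {dO : measure_display} {Ω : measurableType dO}
    (P : probability Ω R) (alpha : Ω -> set (R * R)) (sources sinks : Ω -> set R)
    (eps L c : R) (n : nat) (r := L / (16 * eps)) (d := c ^+ 3 / n%:R) :
  poisson_pp P ((@lebesgue_measure R) \x (@lebesgue_measure R))%E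
    [set p | 0 < p.1 /\ 0 < p.2] alpha ->
  poisson_pp P (@lebesgue_measure R) [set x | 0 < x] sources ->
  indep3 P alpha sources sinks ->
  0 < eps < 1 -> 0 < L -> 1 <= c -> 4 * r <= c -> 2 <= L * c -> (0 < n)%N ->
  d <= 1 -> 90 * d * c ^+ 3 <= r ^+ 3 -> 2 * d <= r / c ->
  (outer_prob P (exit_event alpha sources L eps (c ^+ 3)) <=
   (expR (- (L ^+ 2 / (64 * eps))) + 3 * expR (- (r ^+ 3 / 20)) +
    (2 * (c ^+ 3) ^+ 2 + 1) * c ^+ 3 * d)%:E)%E.
Proof.
move=> aP sP iP /andP[e0 e1] L0 c1 rc Lc n0 d1 hd1 hd2.
have c0 : 0 < c by lra.
have nR : 0 < n%:R :> R by rewrite ltr0n.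
have d0 : 0 < d by rewrite divr_gt0 ?exprn_gt0.
have nd : n%:R * d = c ^+ 3 by rewrite /d mulrC divfK // gt_eqF.
have ec0 : 0 <= eps * c ^+ 2 / d by rewrite divr_ge0 ?mulr_ge0 ?sqr_ge0 // ltW.
(* The number of whole strips in [[0, eps * c ^+ 2]]; it is less than [n] because [eps < 1 <= c]. *)
pose K := Num.truncn (eps * c ^+ 2 / d).
have /andP[K1 K2] : K%:R <= eps * c ^+ 2 / d < K.+1%:R := truncn_itv ec0.
have hK : K%:R * d <= eps * c ^+ 2 by rewrite -ler_pdivlMr.
have hK' : eps * c ^+ 2 < K.+1%:R * d by rewrite -ltr_pdivrMr.
have Kn : (K < n)%N.
  rewrite -(ltr_nat R) -(ltr_pM2r d0) nd (le_lt_trans hK) // [c ^+ 3]exprS.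
  by rewrite ltr_pM2r ?exprn_gt0 // (lt_le_trans e1).
have [E [mE PE GE]] := good_event P _ _ aP sP _ _ _ d0 nd.
have [mF PF] := bits_prob P _ _ _ aP sP iP _ _ _ d0 nd (disc_exit n K (L * c - 1)).
set F := [set w | _] in mF PF.
apply: le_trans (_ : P (F `|` E) <= _)%E.
  apply: ereal_inf_lbound; exists (F `|` E) => //; split; first exact: measurableU.
  move=> w hw; have [hE|/GE[col row one]] := pselect (E w); [by right|left].
  apply: (exit_disc_exit _ _ _ _ _ _ _ _ _ _ _ d0 c0 nd Kn hK' _ col row one _ hw).
  - by move=> i j hi hj; exact: alpha_bitsP.
  - by move=> i x; exact: source_bits_nth.
apply: le_trans (measureU2 _ mF mE) _; rewrite EFinD; apply: leeD => //.
rewrite [leLHS]PF lee_fin; have [_ _ <- _ _] := sqrt_cell d d0 d1.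
exact: disc_exit_bound (ltnW Kn) hK.
Qed.

Theorem theorem5p1 (R : realType) (L : R) (hL : 0 < L) :
  exists C eps0 : R, 0 < eps0 /\
  forall eps : R, 0 < eps -> eps < eps0 ->
  forall (d : measure_display) (Ω : measurableType d) (P : probability Ω R)
         (alpha : Ω -> set (R * R)) (sources sinks : Ω -> set R),
    poisson_pp P ((@lebesgue_measure R) \x (@lebesgue_measure R))%E
      [set p | 0 < p.1 /\ 0 < p.2] alpha ->
    poisson_pp P (@lebesgue_measure R) [set x | 0 < x] sources ->
    poisson_pp P (@lebesgue_measure R) [set x | 0 < x] sinks ->
    indep3 P alpha sources sinks ->
    (* limsup_{t -> oo} P(event) <= C eps^3, written out *)
    forall delta : R, 0 < delta ->
      exists T : R, forall t : R, T <= t ->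
        (outer_prob P (exit_event alpha sources L eps t)
           <= (C * eps ^+ 3 + delta)%:E)%E.
Proof.
(* The two terms come from [expR (- A) <= 6 / A ^+ 3] at [A = L ^+ 2 / (64 * eps)] and from
   [3 * expR (- B) <= 3 / B] at [B = r ^+ 3 / 20]. *)
exists (6 * 64 ^+ 3 / L ^+ 6 + 60 * 16 ^+ 3 / L ^+ 3), 1; split => //.
move=> eps e0 e1 d Ω P alpha sources sinks aP sP _ iP delta dl0.
pose r := L / (16 * eps).
have r0 : 0 < r by rewrite divr_gt0 // mulr_gt0.
(* For [t >= c0 ^+ 3] this ensures [1 <= c], [4 * r <= c] and [2 <= L * c]. *)
pose c0 := 1 + 4 * r + 2 / L.
have L2 : 0 < 2 / L by rewrite divr_gt0.
have c00 : 0 < c0 by rewrite /c0; lra.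
exists (c0 ^+ 3) => t ht.
have t0 : 0 < t by apply: lt_le_trans ht; rewrite exprn_gt0.
pose c := t `^ (1 / 3).
have cE : c ^+ 3 = t.
  by rewrite -powR_mulrn ?powR_ge0 // -powRrM mul1r mulVf ?pnatr_eq0 // powRr1 // ltW.
have c0c : c0 <= c.
  by rewrite -(ler_pXn2r (n := 3)) ?nnegrE ?powR_ge0 ?(ltW c00) // cE.
have c1 : 1 <= c by apply: le_trans c0c; rewrite /c0; lra.
have cp : 0 < c by lra.
have rc : 4 * r <= c by apply: le_trans c0c; rewrite /c0; lra.
have Lc : 2 <= L * c.
  by rewrite mulrC -ler_pdivrMr //; apply: le_trans c0c; rewrite /c0; lra.
(* Taking [n > t * M] puts the mesh [t / n] below [1], [r ^+ 3 / (90 * t)], [r / (2 * c)] and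
   [delta / ((2 * t ^+ 2 + 1) * t)]. The grid depends on [t], and the last summand keeps the
   discretisation error below [delta]. *)
pose M := 1 + 90 * t / r ^+ 3 + 2 * c / r + (2 * t ^+ 2 + 1) * t / delta.
have r3 : 0 < r ^+ 3 by rewrite exprn_gt0.
have M1 : 0 < 90 * t / r ^+ 3 by rewrite divr_gt0 // mulr_gt0.
have M2 : 0 < 2 * c / r by rewrite divr_gt0 // mulr_gt0.
have q0 : 0 < 2 * t ^+ 2 + 1 by have := sqr_ge0 t; lra.
have M3 : 0 < (2 * t ^+ 2 + 1) * t / delta by rewrite divr_gt0 // mulr_gt0.
have [M0 hM1 hM2 hM3] : [/\ 1 <= M, 90 * t / r ^+ 3 <= M, 2 * c / r <= M &
    (2 * t ^+ 2 + 1) * t / delta <= M].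
  rewrite /M; move: (90 * t / r ^+ 3) (2 * c / r) (_ / delta) M1 M2 M3 => x y z.
  by split; lra.
pose n := (Num.truncn (t * M)).+1.
have /andP[_ nM] : (Num.truncn (t * M))%:R <= t * M < n%:R :=
  truncn_itv (mulr_ge0 (ltW t0) (le_trans ler01 M0)).
have nR : 0 < n%:R :> R by rewrite ltr0n.
have dM : t / n%:R * M <= 1 by rewrite mulrAC ler_pdivrMr // mul1r ltW.
have dle y : 0 < y -> y <= M -> t / n%:R <= y^-1.
  move=> y0 yM; rewrite -[y^-1]mul1r ler_pdivlMr //; apply: le_trans dM.
  by apply: ler_wpM2l => //; rewrite divr_ge0 ?ltW.
rewrite -cE; apply: le_trans (outer_exit_le P _ _ _ eps L c n aP sP iP _ hL c1 rc Lc
  (ltn0Sn _) _ _ _) _; rewrite ?cE.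
- by rewrite e0 e1.
- by rewrite -[leRHS]invr1; apply: dle.
- have := dle _ M1 hM1; rewrite invf_div.
  by rewrite ler_pdivlMr ?mulr_gt0 // -/r; lra.
- have := dle _ M2 hM2; rewrite invf_div.
  by rewrite -/r => h; rewrite ler_pdivlMr //; move: h; rewrite ler_pdivlMr ?mulr_gt0 //; lra.
rewrite lee_fin; apply: lerD; last first.
  have := dle _ M3 hM3; rewrite invf_div.
  by rewrite ler_pdivlMr ?mulr_gt0 //; lra.
have en : eps != 0 by rewrite gt_eqF.
have Ln : L != 0 by rewrite gt_eqF.
rewrite [leRHS]mulrDl; apply: lerD.
  have A0 : 0 < L ^+ 2 / (64 * eps) by rewrite divr_gt0 ?exprn_gt0 ?mulr_gt0.
  apply: le_trans (expRN_le_cube _ A0) _.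
  by rewrite le_eqVlt; apply/orP; left; apply/eqP; field; rewrite en Ln.
have B0 : 0 < r ^+ 3 / 20 by rewrite divr_gt0.
apply: le_trans (ler_wpM2l _ (expRN_le_inv _ B0)) _ => //.
by rewrite le_eqVlt; apply/orP; left; apply/eqP; rewrite /r; field; rewrite en Ln.
Qed.
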